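(* Assume $\beta^2>\alpha>1$ and $l=c\log n$ for a constant $c$ with $c\log\alpha<1/4$, and let $(H,\sigma)\sim\mathcal H(n,d,p_n,q_n)$. There exist constants $C,\gamma>0$ such that for all sufficiently large $n$, with probability at least $1-O(n^{-\gamma})$, the following hold for all $i\in[n]$ and all $1\le t\le l$: $$S_t(i)\le C\log(n)\alpha^t,\qquad |D_t(i)|\le C\log(n)\beta^t,$$ $$S_t(i)=\alpha^{t-l}S_l(i)+O(\log(n)\alpha^{t/2}),\qquad D_t(i)=\beta^{t-l}D_l(i)+O(\log(n)\alpha^{t/2}).$$
   Context: Fix an integer $d\ge3$ and constants $a\ge b>0$; $p_n=a/\binom{n}{d-1}$, $q_n=b/\binom{n}{d-1}$. Under $\mathcal H(n,d,p_n,q_n)$, $\sigma\in\{-1,+1\}^n$ has i.i.d. uniform entries, and given $\sigma$ each $d$-subset $e\subset[n]$ is independently a hyperedge of the $d$-uniform hypergraph $H$ on $[n]$ with probability $p_n$ if all spins in $e$ agree and $q_n$ otherwise. $\alpha=(d-1)\frac{a+(2^{d-1}-1)b}{2^{d-1}}$, $\beta=(d-1)\frac{a-b}{2^{d-1}}$. A walk of length $l$ is $(i_0,e_1,i_1,\dots,e_l,i_l)$ with hyperedges $e_j$ of $H$, $i_{j-1}\ne i_j$ and $\{i_{j-1},i_j\}\subset e_j$. The distance $d(i,j)$ is the minimal length of a walk from $i$ to $j$ ($d(i,i)=0$). $V_t(i)=\{j:d(i,j)=t\}$, $S_t(i)=|V_t(i)|$, $D_t(i)=\sum_{j:d(i,j)=t}\sigma_j$.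 *)

(* Defs.v *)
From HB Require Import structures.
From mathcomp Require Import all_boot all_order all_algebra.
From mathcomp Require Import all_classical all_reals all_analysis.
Set Implicit Arguments. Unset Strict Implicit. Unset Printing Implicit Defensive.
Import Order.TTheory GRing.Theory Num.Theory.
Local Open Scope ring_scope.

Section Hyper.
Variable n : nat.
Notation V := ('I_n).

Definition spin (R : realType) (sigma : {ffun V -> bool}) (j : V) : R :=
  if sigma j then 1 else -1.

Definition dsets (d : nat) : {set {set V}} := [set e : {set V} | #|e| == d].

Definition hadj (H : {set {set V}}) (x y : V) : bool :=
  (x != y) && [exists e in H, (x \in e) && (y \in e)].

Fixpoint walk_reach (H : {set {set V}}) (t : nat) (i : V) : {set V} :=
  match t with
  | 0 => [set i]
  | t'.+1 => [set y | [exists x in walk_reach H t' i, hadj H x y]]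
  end.

(* V_t(i) = {j : d(i,j) = t}: a walk of length t exists and no shorter one *)
Definition Vt (H : {set {set V}}) (t : nat) (i : V) : {set V} :=
  [set j | (j \in walk_reach H t i) && [forall s : 'I_t, j \notin walk_reach H s i]].

Definition St (R : realType) (H : {set {set V}}) (t : nat) (i : V) : R :=
  (#|Vt H t i|)%:R.

Definition Dt (R : realType) (sigma : {ffun V -> bool}) (H : {set {set V}})
  (t : nat) (i : V) : R :=
  \sum_(j in Vt H t i) spin R sigma j.

Definition agree (sigma : {ffun V -> bool}) (e : {set V}) : bool :=
  [forall x in e, forall y in e, sigma x == sigma y].

Definition hsbm_weight (R : realType) (d : nat) (p q : R)
  (sigma : {ffun V -> bool}) (H : {set {set V}}) : R :=
  (2 ^+ n)^-1 * \prod_(e in dsets d)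
     (let pe := if agree sigma e then p else q in
      if e \in H then pe else 1 - pe).

Definition hsbm_prob (R : realType) (d : nat) (p q : R)
  (E : {ffun V -> bool} -> {set {set V}} -> bool) : R :=
  \sum_(sigma : {ffun V -> bool})
    \sum_(H : {set {set V}} | (H \subset dsets d) && E sigma H)
       hsbm_weight d p q sigma H.
End Hyper.

Definition alpha (R : realType) (d : nat) (a b : R) : R :=
  (d.-1)%:R * (a + (2 ^+ d.-1 - 1) * b) / 2 ^+ d.-1.
Definition beta (R : realType) (d : nat) (a b : R) : R :=
  (d.-1)%:R * (a - b) / 2 ^+ d.-1.

Definition pn (R : realType) (n d : nat) (a : R) : R := a / ('C(n, d.-1))%:R.

Definition ell (R : realType) (c : R) (n : nat) : nat := Num.truncn (c * ln (n%:R)).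

Definition good_event (R : realType) (n d : nat) (a b C : R) (l : nat)
  (sigma : {ffun 'I_n -> bool}) (H : {set {set 'I_n}}) : bool :=
  let al := alpha d a b in let be := beta d a b in let L := ln (n%:R) in
  [forall i : 'I_n, forall t : 'I_l.+1, (1 <= (t : nat))%N ==>
    [&& St R H t i <= C * L * al ^+ t,
        `|Dt R sigma H t i| <= C * L * be ^+ t,
        `|St R H t i - St R H l i / al ^+ (l - t)| <= C * L * Num.sqrt al ^+ t &
        `|Dt R sigma H t i - Dt R sigma H l i / be ^+ (l - t)|
            <= C * L * Num.sqrt al ^+ t]].

Arguments good_event {R} n d a b C l sigma H.
Arguments hsbm_prob {n R} d p q E.

(* Main.v *)
(* Fix the spins.  Exploring breadth-first from i, the layer V_(t+1) is determined
   by the hyperedges inside the unexplored set U = [n] \ V_(<t) that meet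
   A = V_t, and these are independent of everything revealed before.  Revealing
   them one at a time and recording the newly covered vertices gives an
   exponential supermartingale for the sum of a weight f (f = 1 or f = spin)
   over V_(t+1); its compensator is, up to collisions, the sum of p_e f(e \ A),
   which equals lambda f(A) + O(1), with lambda = alpha or beta, as soon as the
   spins are balanced and |A|, |~: U| = O(n^(1/4) log n).  Tilting by
   theta ~ alpha^(-t/2) shows that, outside an event of probability O(n^-3),
   |f(V_(t+1)) - lambda f(V_t)| = O(log n alpha^(t/2)).  When this holds at every
   level, both the growth bounds and the comparison with level l follow by
   summing geometric series of ratio sqrt alpha / lambda < 1. *)
Require Import Defs.
From HB Require Import structures.
From mathcomp Require Import all_boot all_order all_algebra.
From mathcomp Require Import all_classical all_reals all_analysis.
From mathcomp Require Import ring lra zify.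
From mathcomp Require Import finset.
Import Order.TTheory GRing.Theory Num.Theory.
Set Implicit Arguments. Unset Strict Implicit. Unset Printing Implicit Defensive.
Local Open Scope ring_scope.

(** The tail bound at a level presupposes a bound on the size of the current layer, which is itself
    to be proved. The circle is broken by working under the a priori bound [Q ^+ 2 * L * al ^+ t]
    with [L = ln n]: fluctuations have the order of the square root of a layer, so the deviation
    constant is only linear in [Q], and a large [Q] reproduces the bound at the next level. A second
    obstacle is that the collision term involves the layer being revealed. It stays random inside
    the deviation event and is absorbed afterwards. The condition on [c] gives [al ^+ l <= n^(1/4)],
    so layers and balls are [O(n^(1/4) log n)]. Collisions then cost [O(n^(-1/2) log^2 n)] per
    level, and a spin imbalance of [sqrt n * log n] shifts the mean by [O(n^(-1/4) log^2 n)]; both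
    are eventually below 1. The exponent 3 leaves room for a union bound over [n] roots and
    [O(log n)] levels. The spin imbalance, of probability [O(1/n)], dominates and gives
    [gamma = 1]. *)

(** * Product Bernoulli measures *)

Section BernoulliProduct.
Variables (R : realType) (T : finType) (p : T -> R).
Implicit Types (f g : {set T} -> R) (H : {set T}) (e : T).

Definition bern_weight H : R := \prod_e (if e \in H then p e else 1 - p e).

Definition bern_expect f : R := \sum_(H : {set T}) bern_weight H * f H.

Lemma bern_expect1 : bern_expect (fun _ => 1) = 1.
Proof.
rewrite /bern_expect /bern_weight.
under eq_bigr do rewrite mulr1.
rewrite -(bigA_distr 1 +%R p (fun e => 1 - p e)).
by rewrite big1 // => e _ /=; ring.
Qed.

Lemma eq_bern_expect f g : f =1 g -> bern_expect f = bern_expect g.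
Proof. by move=> fg; apply: eq_bigr => H _; rewrite fg. Qed.

Lemma bern_expectD f g :
  bern_expect (fun H => f H + g H) = bern_expect f + bern_expect g.
Proof. by rewrite -big_split; apply: eq_bigr => H _; rewrite mulrDr. Qed.

Lemma bern_expectZ c f : bern_expect (fun H => c * f H) = c * bern_expect f.
Proof. by rewrite /bern_expect mulr_sumr; apply: eq_bigr => H _; rewrite mulrCA. Qed.

Lemma bern_expect_sum (I : finType) (F : I -> {set T} -> R) :
  bern_expect (fun H => \sum_i F i H) = \sum_i bern_expect (F i).
Proof.
rewrite /bern_expect exchange_big /=; apply: eq_bigr => H _.
by rewrite mulr_sumr.
Qed.

Lemma sum_setU1 (g : {set T} -> R) e :
  \sum_(H : {set T}) g H = \sum_(H : {set T} | e \notin H) (g H + g (e |: H)).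
Proof.
rewrite (bigID (fun H : {set T} => e \notin H)) /= big_split /=; congr (_ + _).
rewrite (reindex_onto (fun H => e |: H) (fun H => H :\ e)) /=.
  apply: eq_bigl => H; rewrite !inE eqxx /=.
  apply/eqP/idP => [<-|eH]; first by rewrite !inE eqxx.
  by rewrite setU1K.
by move=> H; rewrite negbK => eH; rewrite setD1K.
Qed.

Lemma bern_weight_split e :
  {r : {set T} -> R | forall H, e \notin H ->
     bern_weight H = (1 - p e) * r H /\ bern_weight (e |: H) = p e * r H}.
Proof.
exists (fun H => \prod_(x | x != e) (if x \in H then p x else 1 - p x)) => H eH.
rewrite /bern_weight (bigD1 e) //= [X in _ /\ X = _](bigD1 e) //=.
rewrite (negbTE eH) !inE eqxx /=; split => //.
congr (_ * _); apply: eq_bigr => x xe.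
by rewrite !inE (negbTE xe).
Qed.

(** Conditioning on one coordinate. Both conditional expectations are again written under the full
    product measure, with [e] forced in or out, so that an induction over revealed elements never
    changes the measure. *)
Lemma bern_expect_split e f :
  bern_expect f = p e * bern_expect (fun H => f (e |: H))
                + (1 - p e) * bern_expect (fun H => f (H :\ e)).
Proof.
have [r rP] := bern_weight_split e.
rewrite /bern_expect 3!(sum_setU1 _ e) !mulr_sumr -big_split /=.
apply: eq_bigr => H eH; have [-> ->] := rP H eH.
rewrite setU1K // (setUA [set e] [set e]) setUid.
have -> : H :\ e = H by apply/setP => x; rewrite !inE; case: eqP => // ->; rewrite (negbTE eH).
ring.
Qed.

Hypothesis p01 : forall e, 0 <= p e <= 1.

Lemma bern_weight_ge0 H : 0 <= bern_weight H.
Proof.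
apply: prodr_ge0 => e _; have /andP[p0 p1] := p01 e.
by case: ifP => _; rewrite ?subr_ge0.
Qed.

Lemma bern_expect_ge0 f : (forall H, 0 <= f H) -> 0 <= bern_expect f.
Proof.
by move=> f0; apply: sumr_ge0 => H _; rewrite mulr_ge0 ?bern_weight_ge0.
Qed.

Lemma ler_bern_expect f g : (forall H, f H <= g H) -> bern_expect f <= bern_expect g.
Proof.
by move=> fg; apply: ler_sum => H _; rewrite ler_wpM2l ?bern_weight_ge0.
Qed.

Section Reveal.
Variables (X : Type) (upd : T -> X -> X) (w : T -> X -> bool -> R).

Fixpoint reveal H (es : seq T) (x : X) : X :=
  if es is e :: es' then reveal H es' (if e \in H then upd e x else x) else x.

(** The supermartingale: the factor of [e] may depend on the state reached just before [e] is
    revealed. *)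
Fixpoint reveal_weight H (es : seq T) (x : X) : R :=
  if es is e :: es' then
    w e x (e \in H) * reveal_weight H es' (if e \in H then upd e x else x)
  else 1.

Lemma eq_reveal H H' es x : {in es, H =i H'} -> reveal H es x = reveal H' es x.
Proof.
elim: es x => //= e es IH x HH; rewrite (HH e) ?mem_head// IH // => y yes.
by apply: HH; rewrite inE yes orbT.
Qed.

Lemma eq_reveal_weight H H' es x :
  {in es, H =i H'} -> reveal_weight H es x = reveal_weight H' es x.
Proof.
elim: es x => //= e es IH x HH; rewrite (HH e) ?mem_head// IH // => y yes.
by apply: HH; rewrite inE yes orbT.
Qed.

(** Each factor averages to at most 1 given the state before it, and [Phi] ignores the revealed
    elements, so it can be averaged independently of the state reached. Used with [Phi = 1] for the
    Chernoff bound, and with [w = 1] as the Markov property of the exploration. *)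
Lemma bern_expect_reveal (Phi : X -> {set T} -> R) (eps : R) es x :
  (forall e x b, 0 <= w e x b) ->
  (forall e x, e \in es -> p e * w e x true + (1 - p e) * w e x false <= 1) ->
  uniq es ->
  (forall x H H', (forall e, e \notin es -> (e \in H) = (e \in H')) ->
     Phi x H = Phi x H') ->
  (forall x, bern_expect (Phi x) <= eps) -> 0 <= eps ->
  bern_expect (fun H => reveal_weight H es x * Phi (reveal H es x) H) <= eps.
Proof.
move=> w0 w1 + + + eps0; elim: es x w1 Phi => [|e es IH] x w1 Phi /=.
  move=> _ _ ub; rewrite (@eq_bern_expect _ (Phi x)) // => H.
  by rewrite mul1r.
move=> /andP[ees ues] ign ub.
(* The list has no repetition, so forcing [e] into or out of [H] is invisible to all later
   factors. *)
have eqon (H H' : {set T}) : (forall y, y != e -> (y \in H) = (y \in H')) -> {in es, H =i H'}.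
  by move=> HH y yes; apply: HH; apply: contraNneq ees => <-.
have agreeU H y : y != e -> (y \in e |: H) = (y \in H) by move=> ye; rewrite !inE (negbTE ye).
have agreeD H y : y != e -> (y \in H :\ e) = (y \in H) by move=> ye; rewrite !inE ye.
have ignE z H H' : (forall y, y != e -> (y \in H) = (y \in H')) -> Phi z H = Phi z H'.
  by move=> HH; apply: ign => y; rewrite inE negb_or => /andP[ye _]; apply: HH.
have step z : bern_expect (fun H => reveal_weight H es z * Phi (reveal H es z) H) <= eps.
  apply: IH => //; first by move=> y u yes; apply: w1; rewrite inE yes orbT.
  move=> u H H' HH; apply: ign => y; rewrite inE negb_or => /andP[_]; exact: HH.
rewrite (bern_expect_split e).
rewrite (@eq_bern_expect _ (fun H => w e x true *
   (reveal_weight H es (upd e x) * Phi (reveal H es (upd e x)) H))); last first.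
  move=> H /=; rewrite !inE eqxx /= -mulrA; congr (_ * _).
  rewrite (@eq_reveal _ H) ?(@eq_reveal_weight _ H); last 2 first.
  - exact/eqon/agreeU.
  - exact/eqon/agreeU.
  by rewrite (ignE _ _ H) //; apply: agreeU.
rewrite [X in _ + _ * X](@eq_bern_expect _ (fun H => w e x false *
   (reveal_weight H es x * Phi (reveal H es x) H))); last first.
  move=> H /=; rewrite !inE eqxx /= -mulrA; congr (_ * _).
  rewrite (@eq_reveal _ H) ?(@eq_reveal_weight _ H); last 2 first.
  - exact/eqon/agreeD.
  - exact/eqon/agreeD.
  by rewrite (ignE _ _ H) //; apply: agreeD.
rewrite !bern_expectZ !mulrA.
have /andP[p0 p1] := p01 e.
apply: (@le_trans _ _ ((p e * w e x true + (1 - p e) * w e x false) * eps)); last first.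
  by rewrite ler_piMl // w1 // mem_head.
rewrite [leRHS]mulrDl lerD // ler_wpM2l // mulr_ge0 ?w0 ?subr_ge0//.
Qed.

End Reveal.
End BernoulliProduct.

(** * One layer of the exploration *)

Section Layer.
Variables (R : realType) (V : finType) (d : nat) (p : {set V} -> R).
Implicit Types (U A W : {set V}) (H : {set {set V}}) (e : {set V}) (f : V -> R).

Definition frontier_edges U A : {set {set V}} :=
  [set e : {set V} | [&& #|e| == d, e \subset U & e :&: A != set0]].

Definition next_layer U A H : {set V} :=
  \bigcup_(e in frontier_edges U A | e \in H) (e :\: A).

Definition cover_upd A e W : {set V} := W :|: (e :\: A).

Definition vsum f W : R := \sum_(j in W) f j.

Lemma reveal_cover A H es W :
  reveal (cover_upd A) H es W = W :|: \bigcup_(e <- es | e \in H) (e :\: A).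
Proof.
elim: es W => [|e es IH] W /=; first by rewrite big_nil setU0.
rewrite IH big_cons /cover_upd; case: ifP => // _; by rewrite setUA.
Qed.

Lemma reveal_next_layer U A H :
  reveal (cover_upd A) H (enum (frontier_edges U A)) set0 = next_layer U A H.
Proof. by rewrite reveal_cover set0U big_enum_cond. Qed.

Lemma vsumID f W B : vsum f W = vsum f (W :&: B) + vsum f (W :\: B).
Proof. exact: big_setID. Qed.

Lemma vsum1 W : vsum (fun _ => 1) W = #|W|%:R.
Proof. by rewrite /vsum sumr_const. Qed.

Lemma ler_norm_vsum f W : (forall j, `|f j| <= 1) -> `|vsum f W| <= #|W|%:R.
Proof.
move=> f1; apply: le_trans (ler_norm_sum _ _ _) _.
by rewrite -sumr_const; apply: ler_sum.
Qed.

(** From [expR (- x) >= 1 - x] one gets [expR x <= 1 / (1 - x)], and [(1 - x) * (1 + x + 2 x^2) = 1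
    + x^2 * (1 - 2 x) >= 1]. *)
Lemma expR_le_quad (x : R) : x <= 1 / 2 -> expR x <= 1 + x + 2 * x ^+ 2.
Proof.
move=> x2; have := expR_ge1Dx (- x); rewrite expRN => h.
have e0 := expR_gt0 x.
have h1 : (1 - x) * expR x <= 1 by rewrite -ler_pdivlMr // div1r.
have h2 : 1 <= (1 - x) * (1 + x + 2 * x ^+ 2).
  have : 0 <= x ^+ 2 * (1 - 2 * x) by rewrite mulr_ge0 ?sqr_ge0//; lra.
  by lra.
have x1 : 0 < 1 - x by lra.
by rewrite -(ler_pM2l x1); apply: le_trans h1 h2.
Qed.

Section Chernoff.
Hypothesis p01 : forall e, 0 <= p e <= 1.
Variables (U A : {set V}) (f : V -> R) (theta : R).
Hypothesis f1 : forall j, `|f j| <= 1.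
Hypothesis theta_small : `|theta| * d%:R <= 1 / 2.

(** Bounds the quadratic term of [expR_le_quad] uniformly, since an edge adds at most [d] vertices
    of weight at most 1. *)
Let comp := 2 * (theta * d%:R) ^+ 2.

(** Only vertices outside the current cover [W] count, so the increments along the reveal telescope
    to the weight of the union. *)
Definition mgf_weight e W (b : bool) : R :=
  expR ((if b then theta * vsum f ((e :\: A) :\: W) else 0)
        - p e * (theta * vsum f ((e :\: A) :\: W) + comp)).

Lemma mgf_weight_le1 e W : (#|e| <= d)%N ->
  p e * mgf_weight e W true + (1 - p e) * mgf_weight e W false <= 1.
Proof.
move=> ed; rewrite /mgf_weight; set x := theta * _; set c := x + comp.
have /andP[p0 p1] := p01 e.
have xd : `|x| <= `|theta| * d%:R.
  rewrite normrM ler_wpM2l //; apply: le_trans (ler_norm_vsum _ f1) _.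
  rewrite ler_nat; apply: leq_trans ed; apply: subset_leq_card.
  by apply: (fintype.subset_trans (subsetDl _ _)); apply: subsetDl.
have x2 : x ^+ 2 <= (theta * d%:R) ^+ 2.
  rewrite -[x ^+ 2]real_normK ?num_real // -[(_ * _) ^+ 2]real_normK ?num_real //.
  by apply: lerXn2r; rewrite ?nnegrE // (normrM theta d%:R) normr_nat.
have ex : expR x <= 1 + c.
  apply: le_trans (expR_le_quad _) _; last by rewrite /c /comp; lra.
  by apply: le_trans (ler_norm x) _; apply: le_trans xd _.
rewrite add0r !expRD mulrA -mulrDl.
have: p e * expR x + (1 - p e) <= expR (p e * c).
  apply: le_trans (expR_ge1Dx _).
  have := ler_wpM2l p0 ex; rewrite mulrDr mulr1; lra.
by rewrite expRN -[_ <= 1]/(_ / _ <= 1) ler_pdivrMr ?expR_gt0 // mul1r.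
Qed.

(* The overlap sum in the exponent pays for collisions: a vertex covered twice is
   counted once in [W'] but twice in the compensator. *)
Lemma mgf_reveal_ge H es W : (forall e, 0 <= p e) ->
  let W' := reveal (cover_upd A) H es W in
  expR (theta * (vsum f W' - vsum f W)
        - (\sum_(e <- es) p e * (theta * vsum f (e :\: A) + comp)
           + `|theta| * \sum_(e <- es) p e * #|(e :\: A) :&: W'|%:R))
  <= reveal_weight (cover_upd A) mgf_weight H es W.
Proof.
move=> p0 /=; elim: es W => [|e es IH] W /=.
  by rewrite !big_nil; rewrite -[leRHS]expR0 ler_expR; lra.
set W1 := if e \in H then _ else _; set W' := reveal _ _ _ _.
apply: le_trans (ler_wpM2l (expR_ge0 _) (IH W1)).
rewrite -expRD ler_expR -/W' !big_cons.
set S1 := \sum_(_ <- _) _; set S2 := \sum_(_ <- _) _.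
have sub : W \subset W'.
  rewrite /W' reveal_cover /W1 /cover_upd; case: ifP => _.
    by rewrite -setUA subsetUl.
  exact: subsetUl.
have eW1 : vsum f W1 = vsum f W +
    (if e \in H then vsum f ((e :\: A) :\: W) else 0).
  rewrite /W1; case: ifP => _; last by rewrite addr0.
  rewrite /cover_upd (vsumID f (W :|: _) W) setUK; congr (_ + _).
  by rewrite setDUl setDv set0U.
(* The compensator sees only vertices missing from the current cover [W]. Replacing it by the
   deterministic [vsum f (e :\: A)] costs at most the overlap with [W], hence with the larger final
   cover [W']. *)
have hd : `|vsum f (e :\: A) - vsum f ((e :\: A) :\: W)| <= #|(e :\: A) :&: W'|%:R.
  rewrite (vsumID f (e :\: A) W) addrK.
  apply: le_trans (ler_norm_vsum _ f1) _.
  by rewrite ler_nat subset_leq_card // setIS.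
have hd2 : p e * (theta * (vsum f ((e :\: A) :\: W) - vsum f (e :\: A)))
    <= p e * (`|theta| * #|(e :\: A) :&: W'|%:R).
  apply: ler_wpM2l => //; apply: le_trans (ler_norm _) _.
  by rewrite normrM ler_wpM2l // distrC.
move: hd2 eW1; set N := #|_|%:R; set u := vsum f ((e :\: A) :\: W); set v := vsum f (e :\: A).
move=> hd2 ->.
rewrite (_ : (if e \in H then theta * u else 0) = theta * (if e \in H then u else 0)); last first.
  by case: ifP => //; rewrite mulr0.
by lra.
Qed.

Lemma layer_mgf : let FE := frontier_edges U A in
  bern_expect p (fun H => let A' := next_layer U A H in
    expR (theta * vsum f A'
        - (\sum_(e in FE) p e * (theta * vsum f (e :\: A) + comp)
           + `|theta| * \sum_(e in FE) p e * #|(e :\: A) :&: A'|%:R))) <= 1.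
Proof.
set FE := frontier_edges U A => /=.
apply: (@le_trans _ _ (bern_expect p (fun H =>
  reveal_weight (cover_upd A) mgf_weight H (enum FE) set0 * 1))); last first.
  apply: (@bern_expect_reveal _ _ _ p01 _ _ mgf_weight (fun _ _ => 1)) => //.
  - by move=> e W b; apply: expR_ge0.
  - move=> e W; rewrite mem_enum inE => /andP[/eqP ed _]; apply: mgf_weight_le1.
    by rewrite ed.
  - exact: enum_uniq.
  - by move=> _; rewrite bern_expect1.
apply: ler_bern_expect => // H /=; rewrite mulr1.
have p0 e : 0 <= p e by case/andP: (p01 e).
apply: le_trans (mgf_reveal_ge H (enum FE) set0 p0).
rewrite reveal_next_layer -/FE !big_enum /= ler_expR.
by rewrite [vsum f finset.set0]big_set0 subr0.
Qed.

End Chernoff.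

(** * Means and tails of one layer from degrees and codegrees *)

Section Moments.
Hypothesis p0 : forall e, 0 <= p e.
Hypothesis psupp : forall e, #|e| != d -> p e = 0.
Variables (a kappa : R).
Hypothesis deg_le : forall v, \sum_(e : {set V} | v \in e) p e <= a.
Hypothesis codeg_le : forall v w, v != w ->
  \sum_(e : {set V} | (v \in e) && (w \in e)) p e <= kappa.

(** The unit in which collisions are charged: by the codegree bound, its [p]-weighted sum over all
    edges is at most [kappa * |A| * |W|]. *)
Definition pairs_in A W e : R :=
  \sum_(v in A) \sum_(w in W) ([&& v != w, v \in e & w \in e])%:R.

Lemma sum_pairs_in A W : 0 <= kappa ->
  \sum_e p e * pairs_in A W e <= kappa * #|A|%:R * #|W|%:R.
Proof.
move=> k0; rewrite /pairs_in.
under eq_bigr => e _ do rewrite mulr_sumr.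
rewrite exchange_big /=.
have -> : kappa * #|A|%:R * #|W|%:R = \sum_(v in A) \sum_(w in W) kappa.
  by rewrite !sumr_const -[RHS]mulr_natr -[in RHS]mulr_natr; ring.
apply: ler_sum => v _.
under eq_bigr => e _ do rewrite mulr_sumr.
rewrite exchange_big /=; apply: ler_sum => w _.
case: (eqVneq v w) => [_|vw].
  by rewrite big1 // => e _; rewrite mulr0.
apply: le_trans (codeg_le vw); rewrite [leRHS]big_mkcond /=; apply: ler_sum => e _.
by case: (_ && _); rewrite ?mulr1 ?mulr0.
Qed.

Lemma pairs_in_ge1 A W e v w : v \in A -> w \in W -> v != w -> v \in e -> w \in e ->
  1 <= pairs_in A W e.
Proof.
move=> vA wW vw ve we; rewrite /pairs_in (bigD1 v) //= (bigD1 w) //= vw ve we /=.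
rewrite -addrA lerDl; apply: addr_ge0; first exact: sumr_ge0.
by apply: sumr_ge0 => ? _; apply: sumr_ge0.
Qed.

Lemma pairs_in_ge0 A W e : 0 <= pairs_in A W e.
Proof. by do 2!apply: sumr_ge0 => ? _. Qed.

Lemma sum_frontier_le U A : \sum_(e in frontier_edges U A) p e <= a * #|A|%:R.
Proof.
rewrite mulr_natr -sumr_const.
apply: (@le_trans _ _ (\sum_(v in A) \sum_(e : {set V} | v \in e) p e)); last first.
  by apply: ler_sum => v _; apply: deg_le.
under [leRHS]eq_bigr => v _ do rewrite big_mkcond /=.
rewrite exchange_big /= big_mkcond /=; apply: ler_sum => e _.
case: ifP => [|_]; last by apply: sumr_ge0 => v _; case: ifP.
rewrite inE => /and3P[_ _ /set0Pn[v]]; rewrite inE => /andP[ve vA].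
rewrite (bigD1 v) //= ve lerDl; apply: sumr_ge0 => w _; by case: ifP.
Qed.

(** For [v] in [e :&: A], every vertex of [(e :\: A) :&: W] forms a pair with [v], and differs from
    it because it lies outside [A]. *)
Lemma sum_frontier_overlap_le U A W : 0 <= kappa ->
  \sum_(e in frontier_edges U A) p e * #|(e :\: A) :&: W|%:R
    <= kappa * #|A|%:R * #|W|%:R.
Proof.
move=> k0; apply: le_trans (sum_pairs_in A W k0).
rewrite [leLHS]big_mkcond /=; apply: ler_sum => e _.
case: ifP => [|_]; last by rewrite mulr_ge0 ?pairs_in_ge0.
rewrite inE => /and3P[_ _ /set0Pn[v]]; rewrite inE => /andP[ve vA].
apply: ler_wpM2l => //; rewrite /pairs_in (bigD1 v) //=.
apply: ler_wpDr; first by do 2!apply: sumr_ge0 => ? _.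
rewrite -sumr_const big_mkcond [leRHS]big_mkcond /=; apply: ler_sum => w _.
rewrite !inE; case: (boolP (w \in W)) => wW; rewrite ?andbF //=.
rewrite ve /= andbT; case: (boolP (w \in A)) => //= wA.
by case: (w \in e); rewrite ?andbF // andbT (contraNneq _ wA) // => <-.
Qed.

(** Summing the local means over [A] counts an edge once for each of its vertices in [A] and
    includes edges leaving [U]. The resulting error [br e] vanishes unless [e] joins a vertex of [A]
    to another vertex of [A :|: ~: U], and it is at most [d^2 + d <= 2 d^2]; such edges are charged
    to [pairs_in]. *)
Lemma layer_mean f (lam delta : R) U A : A \subset U -> 0 <= kappa ->
  (forall j, `|f j| <= 1) ->
  (forall v, `|\sum_(e : {set V} | v \in e) p e * vsum f (e :\ v) - lam * f v| <= delta) ->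
  `|\sum_(e in frontier_edges U A) p e * vsum f (e :\: A) - lam * vsum f A|
    <= delta * #|A|%:R + 2 * d%:R ^+ 2 * (kappa * #|A|%:R * #|A :|: ~: U|%:R).
Proof.
move=> AU k0 f1 loc.
set M := \sum_(e in _) _.
set br := fun e => \sum_(v in A | v \in e) vsum f (e :\ v)
   - (if e \in frontier_edges U A then vsum f (e :\: A) else 0).
have eT : \sum_(v in A) \sum_(e : {set V} | v \in e) p e * vsum f (e :\ v)
          = M + \sum_e p e * br e.
  under eq_bigr => v _ do rewrite big_mkcond /=.
  rewrite exchange_big /= /M [X in X + _]big_mkcond /= -big_split /=.
  apply: eq_bigr => e _; rewrite -big_mkcondr /= -mulr_sumr /br.
  by case: ifP => _; ring.
have dle (B e : {set V}) : #|e| = d -> `|vsum f (e :\: B)| <= d%:R.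
  move=> ed; apply: le_trans (ler_norm_vsum _ f1) _.
  by rewrite ler_nat -ed subset_leq_card // subsetDl.
have brle e : `|p e * br e| <= 2 * d%:R ^+ 2 * (p e * pairs_in A (A :|: ~: U) e).
  case: (eqVneq #|e| d) => [ed|/psupp->]; last by rewrite !mul0r mulr0 normr0.
  rewrite normrM ger0_norm // mulrCA ler_wpM2l //.
  have pi0 := pairs_in_ge0 A (A :|: ~: U) e.
  case: (set_0Vmem (e :&: A)) => [eA|[v]].
    have -> : br e = 0.
      rewrite /br big1 => [|v /andP[vA ve]]; last first.
        by have := in_set0 v; rewrite -eA inE ve vA.
      by rewrite inE eA eqxx !andbF subrr.
    by rewrite normr0 mulr_ge0 // mulr_ge0 // exprn_ge0.
  rewrite inE => /andP[ve vA].
  have brd : `|br e| <= 2 * d%:R ^+ 2.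
    apply: le_trans (ler_normB _ _) _.
    have d1 : (1 <= d)%N by rewrite -ed; apply/card_gt0P; exists v.
    have dd : (d%:R : R) <= d%:R ^+ 2 by rewrite -natrX ler_nat leq_pmull.
    have: `|\sum_(v in A | v \in e) vsum f (e :\ v)| <= d%:R ^+ 2.
      apply: le_trans (ler_norm_sum _ _ _) _.
      apply: (@le_trans _ _ (\sum_(v in A | v \in e) d%:R)).
        by apply: ler_sum => u _; apply: dle.
      rewrite sumr_const -[leLHS]mulr_natr expr2 ler_wpM2l // ler_nat -ed.
      by apply: subset_leq_card; apply/fintype.subsetP => u /andP[].
    have: `|if e \in frontier_edges U A then vsum f (e :\: A) else 0| <= d%:R.
      by case: ifP => _; rewrite ?normr0 // dle.
    by lra.
  have done_pair w : w \in A :|: ~: U -> v != w -> w \in e ->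
      `|br e| <= 2 * d%:R ^+ 2 * pairs_in A (A :|: ~: U) e.
    move=> wB vw we; apply: le_trans brd _; rewrite ler_peMr ?mulr_ge0 ?exprn_ge0 //.
    exact: (pairs_in_ge1 vA wB vw ve we).
  case: (boolP (e \subset U)) => [eU|/subsetPn[w we wU]]; last first.
    apply: (done_pair w) => //; first by rewrite !inE wU orbT.
    by apply: contraNneq wU => <-; apply: (fintype.subsetP AU).
  case: (boolP (e :&: A == [set v])) => [/eqP eA|neA]; last first.
    have /subsetPn[w] : ~~ (e :&: A \subset [set v]).
      apply: contra neA => h; rewrite eqEsubset h sub1set inE ve vA //.
    rewrite !inE => /andP[we wA] wv; apply: (done_pair w) => //; last by rewrite eq_sym.
    by rewrite !inE wA.
  (* The remaining case: [e] lies in [U] and meets [A] only in [v], so [e :\ v = e :\: A] and the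
     two terms cancel. *)
  have -> : br e = 0; last by rewrite normr0 mulr_ge0 // mulr_ge0 // exprn_ge0.
  have eFE : e \in frontier_edges U A.
    by rewrite inE ed eqxx eU eA; apply/set0Pn; exists v; rewrite inE.
  rewrite /br eFE (big_pred1 v) => [|u]; last first.
    by rewrite /= andbC -in_setI eA inE.
  have -> : e :\ v = e :\: A; last by rewrite subrr.
  by rewrite -eA setDIr setDv set0U.
have hbr : `|\sum_e p e * br e| <= 2 * d%:R ^+ 2 * (kappa * #|A|%:R * #|A :|: ~: U|%:R).
  apply: le_trans (ler_norm_sum _ _ _) _.
  apply: (@le_trans _ _ (\sum_e 2 * d%:R ^+ 2 * (p e * pairs_in A (A :|: ~: U) e))).
    by apply: ler_sum => e _; apply: brle.
  by rewrite -mulr_sumr ler_wpM2l ?sum_pairs_in // mulr_ge0 // exprn_ge0.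
have hT : `|\sum_(v in A) \sum_(e : {set V} | v \in e) p e * vsum f (e :\ v)
    - lam * vsum f A| <= delta * #|A|%:R.
  rewrite /vsum mulr_sumr -sumrB; apply: le_trans (ler_norm_sum _ _ _) _.
  by rewrite mulr_natr -sumr_const; apply: ler_sum => v _; apply: loc.
rewrite eT in hT.
have -> : M - lam * vsum f A = (M + \sum_e p e * br e - lam * vsum f A) - \sum_e p e * br e by ring.
by apply: le_trans (ler_normB _ _) _; apply: lerD.
Qed.

(** Markov's inequality for [layer_mgf]. In the threshold, [1] pays for the error of the mean and
    [kappa * |A| * |A'|] for the overlaps, so only [s] remains in the exponent. The sign of [theta]
    selects the tail. *)
Lemma layer_tail f (lam theta s : R) U A : (forall e, p e <= 1) -> 0 <= kappa ->
  (forall j, `|f j| <= 1) -> `|theta| * d%:R <= 1 / 2 ->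
  `|\sum_(e in frontier_edges U A) p e * vsum f (e :\: A) - lam * vsum f A| <= 1 ->
  bern_expect p (fun H => let A' := next_layer U A H in
    (`|theta| * (s + 1 + kappa * #|A|%:R * #|A'|%:R)
      < theta * (vsum f A' - lam * vsum f A))%R%:R)
  <= expR (2 * (theta * d%:R) ^+ 2 * (a * #|A|%:R) - `|theta| * s).
Proof.
move=> p1 k0 f1 th mean.
have p01 e : 0 <= p e <= 1 by rewrite p0 p1.
set c := 2 * _; set M := \sum_(e in _) _ in mean.
have mgf := layer_mgf p01 U A f1 th.
rewrite -[leRHS]mulr1; apply: le_trans (ler_wpM2l (expR_ge0 _) mgf).
rewrite -bern_expectZ; apply: ler_bern_expect => // H /=.
set A' := next_layer _ _ _; rewrite -expRD.
case: (boolP (_ < _)) => [lt|_]; last exact: expR_ge0.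
rewrite -[leLHS]expR0 ler_expR -/c.
have -> : \sum_(e in frontier_edges U A) p e * (theta * vsum f (e :\: A) + c)
  = theta * M + c * \sum_(e in frontier_edges U A) p e.
  rewrite /M !mulr_sumr -big_split /=; apply: eq_bigr => e _; ring.
have c0 : 0 <= c by rewrite /c mulr_ge0 // sqr_ge0.
have h1 := ler_wpM2l c0 (sum_frontier_le U A).
have h2 := ler_wpM2l (normr_ge0 theta) (sum_frontier_overlap_le U A A' k0).
have h3 : theta * (M - lam * vsum f A) <= `|theta|.
  apply: le_trans (ler_norm _) _; rewrite normrM -[leRHS]mulr1 ler_wpM2l //.
by lra.
Qed.

End Moments.
End Layer.

(** * Breadth-first exploration *)

Section Exploration.
Variables (n d : nat).
Notation V := 'I_n.
Implicit Types (H : {set {set V}}) (U A W : {set V}) (i : V) (t : nat).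

Definition Vlt H t i : {set V} := \bigcup_(s < t) Vt H s i.

Lemma VltS H t i : Vlt H t.+1 i = Vlt H t i :|: Vt H t i.
Proof. exact: big_ord_recr. Qed.

Lemma mem_Vlt H t i x :
  (x \in Vlt H t i) = [exists s : 'I_t, x \in walk_reach H s i].
Proof.
apply/bigcupP/existsP => [[s _]|[s xs]].
  by rewrite inE => /andP[xs _]; exists s.
have ex : exists s, x \in walk_reach H s i by exists s.
case: (ex_minnP ex) => m xm mmin.
have mt : (m < t)%N by apply: leq_ltn_trans (mmin _ xs) _.
exists (Ordinal mt) => //; rewrite inE xm /=.
by apply/forallP => u; apply/negP => /mmin; rewrite leqNgt ltn_ord.
Qed.

Lemma mem_Vt H t i x : (x \in Vt H t i) = (x \in walk_reach H t i) && (x \notin Vlt H t i).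
Proof. by rewrite inE mem_Vlt negb_exists. Qed.

(** An edge used for the last step to [y] contains no vertex [z] reached in fewer than [t] steps,
    since [z] would give a walk to [y] of length at most [t]. Hence the edge lies in the unexplored
    set. *)
Lemma Vt_succ H t i : H \subset dsets n d ->
  Vt H t.+1 i = next_layer d (~: Vlt H t i) (Vt H t i) H.
Proof.
move=> Hd; apply/setP => y; apply/idP/bigcupP => [|[e /andP[]]].
  rewrite mem_Vt => /andP[/=]; rewrite inE => /existsP[x /andP[xt xy]].
  rewrite mem_Vlt negb_exists => /forallP ny.
  have nreach s z : (s < t.+1)%N -> z \in walk_reach H s i -> z != y.
    by move=> st zs; apply: contraTneq zs => ->; exact: (ny (Ordinal st)).
  have nadj s z : (s < t)%N -> z \in walk_reach H s i -> ~~ hadj H z y.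
    move=> st zs; apply/negP => zy; have := ny (Ordinal (st : (s.+1 < t.+1)%N)).
    by rewrite /= inE => /existsP[]; exists z; rewrite zs.
  have xV : x \in Vt H t i.
    rewrite mem_Vt xt /= mem_Vlt; apply/existsPn => s.
    by apply/negP => xs; have := nadj _ _ (ltn_ord s) xs; rewrite xy.
  case/andP: xy => xy /existsP[e /and3P[eH xe ye]].
  exists e; rewrite ?eH ?andbT; last first.
    rewrite inE ye andbT; apply/negP; rewrite mem_Vt => /andP[yt _].
    by have := nreach t y (ltnSn t) yt; rewrite eqxx.
  rewrite inE; apply/and3P; split.
  - by have := fintype.subsetP Hd e eH; rewrite inE.
  - apply/fintype.subsetP => z ze; rewrite inE mem_Vlt; apply/existsPn => s.
    apply/negP => zs.
    have zy : z != y := nreach s z (ltnW (ltn_ord s)) zs.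
    have := nadj s z (ltn_ord s) zs; rewrite /hadj zy /= => /existsP[].
    by exists e; rewrite eH ze ye.
  - by apply/set0Pn; exists x; rewrite inE xe xV.
rewrite inE => /and3P[_ eU /set0Pn[x]]; rewrite inE => /andP[xe xV] eH.
rewrite inE => /andP[yV ye].
have yB : y \notin Vlt H t i by have := fintype.subsetP eU y ye; rewrite inE.
rewrite mem_Vt VltS in_setU negb_or yB yV !andbT /= inE.
apply/existsP; exists x; move: (xV); rewrite mem_Vt => /andP[-> _] /=.
rewrite /hadj (contraNneq _ yV) => [/=|<- //].
by apply/existsP; exists e; rewrite eH xe ye.
Qed.

Lemma eq_next_layer U A H H' :
  (forall e : {set V}, e \subset U -> (e \in H) = (e \in H')) ->
  next_layer d U A H = next_layer d U A H'.
Proof.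
move=> HH; apply: eq_bigl => e; case: (boolP (e \in frontier_edges _ _ _)) => //=.
by rewrite inE => /and3P[_ eU _]; exact: HH.
Qed.

Variable step_bad : nat -> {set V} -> {set V} -> {set V} -> bool.

(** A recursion from an arbitrary pair [(U, A)], not a statement about the layers of [H]: after one
    level is revealed, the rest is again an exploration with a new start, to which induction
    applies. *)
Fixpoint explore_bad k t U A H : bool :=
  if k is k'.+1 then
    step_bad t U A (next_layer d U A H)
    || explore_bad k' t.+1 (U :\: A) (next_layer d U A H) H
  else false.

Lemma eq_explore_bad k t U A H H' :
  (forall e : {set V}, e \subset U -> (e \in H) = (e \in H')) ->
  explore_bad k t U A H = explore_bad k t U A H'.
Proof.
elim: k t U A => //= k IH t U A HH; rewrite (eq_next_layer _ HH).
congr (_ || _); apply: IH => e eU; apply: HH.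
by apply: fintype.subset_trans eU _; apply: subsetDl.
Qed.

(** A union bound over levels. Conditioning on the revealed layer is [bern_expect_reveal] with
    trivial weights, and works because the step bound is uniform in [U] and [A]. *)
Lemma explore_bad_expect (R : realType) (p : {set V} -> R) (eps : R) k t U A :
  (forall e, 0 <= p e <= 1) -> 0 <= eps ->
  (forall t U A, bern_expect p (fun H => (step_bad t U A (next_layer d U A H))%:R) <= eps) ->
  bern_expect p (fun H => (explore_bad k t U A H)%:R) <= k%:R * eps.
Proof.
move=> p01 e0 hs; elim: k t U A => [|k IH] t U A /=.
  by rewrite mul0r /bern_expect big1 // => H _; rewrite mulr0.
apply: (@le_trans _ _ (bern_expect p (fun H => (step_bad t U A (next_layer d U A H))%:R
   + (explore_bad k t.+1 (U :\: A) (next_layer d U A H) H)%:R))).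
  apply: ler_bern_expect => // H; rewrite -natrD ler_nat.
  by case: (explore_bad _ _ _ _ _); case: (step_bad _ _ _ _).
rewrite bern_expectD -[k.+1]addn1 natrD mulrDl mul1r addrC lerD //.
apply: le_trans (_ : bern_expect p (fun H =>
    reveal_weight (cover_upd A) (fun _ _ _ => 1) H (enum (frontier_edges d U A)) finset.set0
     * (explore_bad k t.+1 (U :\: A)
         (reveal (cover_upd A) H (enum (frontier_edges d U A)) finset.set0) H)%:R) <= _).
  apply: ler_bern_expect => // H; rewrite reveal_next_layer.
  set w := reveal_weight _ _ _ _ _.
  suff -> : w = 1 by rewrite mul1r.
  rewrite /w; elim: (enum _) finset.set0 => //= e es IHes x; by rewrite mul1r.
apply: (@bern_expect_reveal _ _ _ p01 _ (cover_upd A) (fun _ _ _ => 1)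
  (fun W H => (explore_bad k t.+1 (U :\: A) W H)%:R)) => //.
- by move=> e _ _; lra.
- exact: enum_uniq.
(* Later levels use only edges inside [U :\: A]; these miss [A], so none of them has been
   revealed. *)
- move=> W H H' HH; congr (nat_of_bool _)%:R; apply: eq_explore_bad => e.
  rewrite subsetD => /andP[eU dis]; apply: HH; rewrite mem_enum inE setI_eq0 dis /=.
  by rewrite !andbF.
- by rewrite mulr_ge0.
Qed.

Lemma explore_badN k H i : H \subset dsets n d ->
  ~~ explore_bad k 0 [set: V] [set i] H ->
  forall t, (t < k)%N -> ~~ step_bad t (~: Vlt H t i) (Vt H t i) (Vt H t.+1 i).
Proof.
move=> Hd nb.
suff main t0 : ~~ explore_bad k t0 (~: Vlt H t0 i) (Vt H t0 i) H ->
    forall t, (t < k)%N -> ~~ step_bad (t0 + t) (~: Vlt H (t0 + t) i)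
       (Vt H (t0 + t) i) (Vt H (t0 + t).+1 i).
  apply: (main 0%N); rewrite {1}/Vlt big_ord0 setC0.
  suff -> : Vt H 0 i = [set i] by [].
  by apply/setP => x; rewrite mem_Vt /Vlt big_ord0 !inE andbT.
elim: k t0 {nb} => // k IH t0 /=; rewrite negb_or -Vt_succ // => /andP[nb0].
rewrite setDE -setCU -VltS => /IH nb [|t]; first by rewrite addn0.
by rewrite ltnS => /nb; rewrite addSnnS.
Qed.

End Exploration.

(** * Local means *)

Lemma card_between (T : finType) (B S : {set T}) d : B \subset S -> (#|B| <= d)%N ->
  #|[set e : {set T} | [&& #|e| == d, B \subset e & e \subset S]]| = 'C(#|S| - #|B|, d - #|B|).
Proof.
move=> BS Bd; rewrite -(cardsDS BS) -cards_draws.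
have inj : {in [set x : {set T} | x \subset S :\: B & #|x| == (d - #|B|)%N] &, injective (fun x => x :|: B)}.
  have K x : x \in [set x : {set T} | x \subset S :\: B & #|x| == (d - #|B|)%N] -> (x :|: B) :\: B = x.
    rewrite inE subsetD => /andP[/andP[_ xB] _].
    by rewrite setDUl setDv setU0; apply/setDidPl.
  by move=> x y /K xK /K yK /= xy; rewrite -xK xy yK.
rewrite -(card_in_imset inj); apply: eq_card => e; rewrite inE.
apply/and3P/imsetP => [[/eqP ed Be eS]|[x]].
  exists (e :\: B); last first.
    apply/setP => y; rewrite !inE; case: (boolP (y \in B)) => [/(fintype.subsetP Be)->|_] //=.
    by rewrite orbF.
  by rewrite inE setSD // cardsDS // ed eqxx.
rewrite inE subsetD => /andP[/andP[xS xB] /eqP xd] ->; split.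
- by rewrite cardsU disjoint_setI0 // cards0 subn0 xd subnK.
- exact: subsetUr.
- by rewrite subUset xS.
Qed.

(** The ratio is a product of factors [(m - j) / (n - j)], each in [[0, 1]] and within
    [2 (mu + d) / n] of [h], so the errors add up. The 2 comes from [n - j >= n / 2]. *)
Lemma bin_ratio (R : realFieldType) (h mu : R) (m n r d : nat) :
  0 <= h <= 1 -> (m <= n)%N -> (2 * d <= n)%N -> (r <= d)%N -> `|m%:R - h * n%:R| <= mu ->
  (0 < n)%N ->
  `|('C(m, r))%:R / ('C(n, r))%:R - h ^+ r| <= r%:R * (2 * (mu + d%:R) / n%:R).
Proof.
move=> /andP[h0 h1] mn dn + hmu n0; elim: r => [|r IH] rd.
  by rewrite !bin0 expr0 divr1 subrr normr0 mul0r.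
have {}IH := IH (ltnW rd).
have rn : (r < n)%N by lia.
have binS k : ('C(k, r.+1))%:R = ('C(k, r))%:R * (k - r)%:R / r.+1%:R :> R.
  apply: (@mulIf _ r.+1%:R); first by rewrite pnatr_eq0.
  rewrite divfK ?pnatr_eq0 // -!natrM; congr _%:R.
  by rewrite mulnC mul_bin_left mulnC.
have nr0 : 0 < (n - r)%:R :> R by rewrite ltr0n subn_gt0.
have Cn0 : 0 < ('C(n, r))%:R :> R by rewrite ltr0n bin_gt0 ltnW.
set q := ('C(m, r))%:R / ('C(n, r))%:R in IH.
set g : R := (m - r)%:R / (n - r)%:R.
have -> : ('C(m, r.+1))%:R / ('C(n, r.+1))%:R = q * g.
  rewrite !binS /q /g; field.
  by rewrite nat1r (gt_eqF nr0) (gt_eqF Cn0) pnatr_eq0.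
have g01 : 0 <= g <= 1.
  apply/andP; split; first exact: divr_ge0.
  by rewrite ler_pdivrMr // mul1r ler_nat; apply: leq_sub2r.
have hr01 : 0 <= h ^+ r <= 1 by rewrite exprn_ge0 //= exprn_ile1.
have n0' : 0 < n%:R :> R by rewrite ltr0n.
have gh : `|g - h| <= 2 * (mu + d%:R) / n%:R.
  have -> : g - h = ((m - r)%:R - h * (n - r)%:R) / (n - r)%:R.
    by rewrite /g mulrBl mulfK // gt_eqF.
  have rd' : r%:R <= d%:R :> R by rewrite ler_nat ltnW.
  have enr : (n - r)%:R = n%:R - r%:R :> R by rewrite natrB // ltnW.
  have num : `|(m - r)%:R - h * (n - r)%:R| <= mu + d%:R.
    have hr : 0 <= h * r%:R <= r%:R by rewrite mulr_ge0 //= ler_piMl.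
    have hn : 0 <= h * (n - r)%:R by rewrite mulr_ge0 // ltW.
    move: hmu hn; rewrite enr !ler_norml => hmu hn.
    (* For [m < r] the truncated difference is 0, and [h * n <= m + mu <= d + mu] still gives the
       bound. *)
    have [rm|mr] := leqP r m; first by rewrite natrB //; lra.
    have mr' : m%:R <= r%:R :> R by rewrite ler_nat ltnW.
    by rewrite (eqP (ltnW mr : m - r == 0)%N); lra.
  have num0 : 0 <= mu + d%:R by apply: le_trans num.
  rewrite normrM normfV (ger0_norm (ltW nr0)) ler_pdivrMr //.
  apply: le_trans num _.
  rewrite (_ : _ / _ * _ = (mu + d%:R) * (2 * (n - r)%:R / n%:R)); last by ring.
  rewrite ler_peMr // ler_pdivlMr // mul1r enr.
  by have : 2 * d%:R <= n%:R :> R by [rewrite -natrM ler_nat]; lra.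
have -> : q * g - h ^+ r.+1 = (q - h ^+ r) * g + h ^+ r * (g - h) by rewrite exprSr; ring.
rewrite -[r.+1%:R]nat1r [leRHS]mulrDl mul1r [leRHS]addrC; apply: le_trans (ler_normD _ _) _; apply: lerD.
- rewrite normrM; apply: le_trans IH.
  by rewrite ler_piMr // ger0_norm; case/andP: g01.
- rewrite normrM; apply: le_trans gh.
  by rewrite ler_piMl // ger0_norm; case/andP: hr01.
Qed.

Section LocalMeans.
Variables (R : realType) (n d : nat) (a b tau : R) (sigma : {ffun 'I_n -> bool}).
Notation V := 'I_n.
Hypotheses (d3 : (3 <= d)%N) (dn : (2 * d <= n)%N) (b0 : 0 < b) (ba : b <= a).
Implicit Types (e : {set V}) (v w : V).

(** Extended by 0 to sets of the wrong size: the hypergraph becomes a product measure over all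
    vertex subsets, and any [H] outside [dsets] has weight 0. *)
Definition edge_prob e : R :=
  if #|e| == d then (if agree sigma e then pn n d a else pn n d b) else 0.

Let N : R := ('C(n, d.-1))%:R.
Lemma vertices_gt0 : 0 < n%:R :> R. Proof. by rewrite ltr0n; clear -d3 dn; lia. Qed.
Lemma binom_gt0 : 0 < N. Proof. by rewrite ltr0n bin_gt0; clear -d3 dn; lia. Qed.
Lemma inner_rate_gt0 : 0 < a. Proof. exact: lt_le_trans ba. Qed.

Local Hint Resolve vertices_gt0 binom_gt0 inner_rate_gt0 : core.

Lemma edge_prob_ge0 e : 0 <= edge_prob e.
Proof.
rewrite /edge_prob /pn -/N; case: ifP => // _.
by case: ifP => _; rewrite divr_ge0 // ltW.
Qed.

Lemma edge_prob_le e : edge_prob e <= a / N.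
Proof.
rewrite /edge_prob /pn -/N; case: ifP => _; last by rewrite divr_ge0 // ltW.
by case: ifP => _ //; rewrite ler_pM2r // invr_gt0.
Qed.

Lemma edge_prob_supp e : #|e| != d -> edge_prob e = 0.
Proof. by rewrite /edge_prob => /negbTE ->. Qed.

Lemma spinE v w : spin R sigma v * spin R sigma w = if sigma v == sigma w then 1 else -1.
Proof. by rewrite /spin; case: (sigma v); case: (sigma w); rewrite /=; ring. Qed.

Lemma spin_norm v : `|spin R sigma v| <= 1.
Proof. by rewrite /spin; case: ifP; rewrite ?normrN normr1. Qed.

Definition same_spin v : {set V} := [set w | sigma v == sigma w].

Lemma agreeE e v : v \in e -> agree sigma e = (e \subset same_spin v).
Proof.
move=> ve; apply/forall_inP/fintype.subsetP => [h w we|h x xe].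
  by rewrite inE; have /forall_inP := h v ve; apply.
apply/forall_inP => y ye; have := h x xe; have := h y ye; rewrite !inE.
by move=> /eqP <- /eqP <-.
Qed.

Lemma sum_edges_at (c : R) (v : V) (S : {set V}) : v \in S ->
  \sum_(e : {set V} | [&& #|e| == d, v \in e & e \subset S]) c = ('C(#|S|.-1, d.-1))%:R * c.
Proof.
move=> vS; have := @card_between _ [set v] S d.
rewrite sub1set vS cards1 !subn1 => <- //; last by clear -d3; lia.
rewrite mulr_natl -sumr_const; apply: eq_bigl => e.
by rewrite inE sub1set.
Qed.

Lemma sum_edges_at2 (c : R) (v w : V) : v != w ->
  \sum_(e : {set V} | [&& #|e| == d, v \in e & w \in e]) c = ('C(n - 2, d - 2))%:R * c.
Proof.
move=> vw; have := @card_between _ [set v; w] [set: V] d.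
rewrite subsetT cards2 vw cardsT card_ord => <- //; last by clear -d3; lia.
rewrite mulr_natl -sumr_const; apply: eq_bigl => e.
by rewrite inE subsetT andbT subUset !sub1set.
Qed.

(** Follows from [(d - 1) * C(n, d - 1) = n * C(n - 1, d - 2)]. *)
Lemma codeg_ratio : ('C(n - 2, d - 2))%:R / N <= d%:R / n%:R.
Proof.
rewrite ler_pdivrMr // mulrAC ler_pdivlMr // /N -!natrM ler_nat.
have e1 : (d.-1 * 'C(n, d.-1) = n * 'C(n.-1, d - 2))%N.
  have -> : d.-1 = (d - 2).+1 by clear -d3; lia.
  by rewrite mul_bin_diag.
apply: (@leq_trans (d.-1 * 'C(n, d.-1))); last by rewrite leq_mul2r leq_pred orbT.
by rewrite e1 mulnC leq_mul2l leq_bin2l ?orbT //; clear -d3 dn; lia.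
Qed.

Lemma edge_prob_deg v : \sum_(e : {set V} | v \in e) edge_prob e <= a.
Proof.
apply: (@le_trans _ _ (\sum_(e : {set V} | [&& #|e| == d, v \in e & e \subset [set: V]]) a / N)).
  rewrite big_mkcond [leRHS]big_mkcond /=; apply: ler_sum => e _.
  rewrite subsetT andbT andbC; case: (v \in e) => //=.
  by case: ifP => [_|/negbT/edge_prob_supp->//]; apply: edge_prob_le.
rewrite sum_edges_at ?inE // cardsT card_ord mulrCA ler_piMr ?(ltW inner_rate_gt0) //.
by rewrite ler_pdivrMr // mul1r ler_nat leq_bin2l // leq_pred.
Qed.

Lemma edge_prob_codeg v w : v != w ->
  \sum_(e : {set V} | (v \in e) && (w \in e)) edge_prob e <= a * d%:R / n%:R.
Proof.
move=> vw.
apply: (@le_trans _ _ (\sum_(e : {set V} | [&& #|e| == d, v \in e & w \in e]) a / N)).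
  rewrite big_mkcond [leRHS]big_mkcond /=; apply: ler_sum => e _.
  case: (v \in e); case: (w \in e); rewrite ?andbF ?andbT //=.
  by case: ifP => [_|/negbT/edge_prob_supp->//]; apply: edge_prob_le.
by rewrite sum_edges_at2 // mulrCA -mulrA ler_pM2l // codeg_ratio.
Qed.

Hypothesis balanced : `|\sum_j spin R sigma j| <= tau.

(** Multiplying the total spin by the spin of [v] counts agreeing minus disagreeing vertices. *)
Lemma card_same_spin v : `|2 * #|same_spin v|%:R - n%:R| <= tau.
Proof.
apply: le_trans balanced.
have -> : 2 * #|same_spin v|%:R - n%:R = spin R sigma v * \sum_j spin R sigma j.
  rewrite mulr_sumr -sumr_const mulr_sumr.
  rewrite -[in X in _ - X](card_ord n) -sumr_const [X in X - _]big_mkcond -sumrB /=.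
  by apply: eq_bigr => w _; rewrite spinE inE; case: eqP => _; ring.
by rewrite normrM ler_piMl // spin_norm.
Qed.

Lemma tau_ge0 : 0 <= tau.
Proof. exact: le_trans balanced. Qed.

Let eps : R := d%:R * (2 * (tau + 1 + d%:R) / n%:R).

Lemma ratio_all : `|('C(n.-1, d.-1))%:R / N - 1| <= eps.
Proof.
have := @bin_ratio R 1 1 n.-1 n d.-1 d; rewrite expr1n => h.
have n0 : (0 < n)%N by rewrite -(ltr0n R) vertices_gt0.
apply: le_trans (h _ (leq_pred n) dn (leq_pred d) _ n0) _.
- by rewrite ler01 lexx.
- rewrite mul1r -[in X in _ - X](prednK n0).
  by rewrite -natr1 opprD addrA subrr add0r normrN normr1.
- rewrite /eps; have t0 := tau_ge0.
  have dd : d.-1%:R <= d%:R :> R by rewrite ler_nat leq_pred.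
  apply: ler_pM => //.
  by rewrite ler_pM2r ?invr_gt0 //; lra.
Qed.

Lemma ratio_same v : `|('C(#|same_spin v|.-1, d.-1))%:R / N - 2^-1 ^+ d.-1| <= eps.
Proof.
have t0 := tau_ge0.
have n0 : (0 < n)%N by rewrite -(ltr0n R) vertices_gt0.
have sn : (#|same_spin v| <= n)%N by rewrite -[X in (_ <= X)%N](card_ord n) max_card.
have s0 : (0 < #|same_spin v|)%N by apply/card_gt0P; exists v; rewrite inE.
have mn : (#|same_spin v|.-1 <= n)%N := leq_trans (leq_pred _) sn.
apply: le_trans (@bin_ratio R 2^-1 (tau + 1) _ _ _ _ _ mn dn (leq_pred d) _ n0) _.
- by rewrite invr_ge0 ler0n /= invf_le1 // ler1n.
- have := card_same_spin v; rewrite -[in X in X -> _](@prednK #|same_spin v|) //.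
  by rewrite -(natr1 #|same_spin v|.-1) !ler_norml; lra.
- have dd : d.-1%:R <= d%:R :> R by rewrite ler_nat leq_pred.
  by rewrite /eps; apply: ler_pM => //; rewrite divr_ge0 // ?mulr_ge0 ?addr_ge0 // ltW.
Qed.

(* Splitting [p_e] as [b/N + 1_{agree} (a-b)/N] separates the two binomial ratios. *)
Lemma edge_prob_split v (g : {set V} -> R) :
  \sum_(e : {set V} | v \in e) edge_prob e * g e
  = b / N * \sum_(e : {set V} | [&& #|e| == d, v \in e & e \subset [set: V]]) g e
    + (a - b) / N * \sum_(e : {set V} | [&& #|e| == d, v \in e & e \subset same_spin v]) g e.
Proof.
rewrite !mulr_sumr big_mkcond [in X in X + _]big_mkcond [in X in _ + X]big_mkcond.
rewrite -big_split /=; apply: eq_bigr => e _.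
rewrite subsetT andbT; case: (boolP (v \in e)) => ve; rewrite ?andbF ?addr0 //=.
rewrite andbT -(agreeE ve) /edge_prob /pn -/N; case: ifP => _ /=; last by rewrite addr0 mul0r.
by case: ifP => _; rewrite ?addr0 //; field; rewrite gt_eqF.
Qed.

Definition mean_err : R := 3 * a * d%:R ^+ 2 * ((tau + 1 + d%:R) / n%:R).

(** Each edge at [v] brings [d - 1] other vertices. About a fraction [2^-(d-1)] of these edges is
    monochromatic, which yields [(d - 1) * (b + (a - b) / 2^(d-1)) = alpha]. *)
Lemma local_mean_card v :
  `|\sum_(e : {set V} | v \in e) edge_prob e * vsum (fun _ => 1) (e :\ v)
     - alpha d a b * 1| <= mean_err.
Proof.
have -> : \sum_(e : {set V} | v \in e) edge_prob e * vsum (fun _ => 1) (e :\ v)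
   = \sum_(e : {set V} | v \in e) edge_prob e * (d.-1)%:R.
  apply: eq_bigr => e ve; case: (eqVneq #|e| d) => [ed|/edge_prob_supp->]; last by rewrite !mul0r.
  by rewrite vsum1; congr (_ * _%:R); have := cardsD1 v e; rewrite ve ed => ->.
rewrite edge_prob_split !sum_edges_at ?inE // cardsT card_ord.
have r1 := ratio_all; have r2 := ratio_same v; have t0 := tau_ge0.
set x := _ / N in r1; set y := _ / N in r2.
have -> : b / N * (('C(n.-1, d.-1))%:R * (d.-1)%:R)
   + (a - b) / N * (('C(#|same_spin v|.-1, d.-1))%:R * (d.-1)%:R) - alpha d a b * 1
   = (d.-1)%:R * (b * (x - 1) + (a - b) * (y - 2^-1 ^+ d.-1)).
  rewrite /alpha /x /y exprVn; field.
  by rewrite (gt_eqF binom_gt0) ?expf_neq0 ?pnatr_eq0.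
rewrite normrM normr_nat.
have : `|b * (x - 1) + (a - b) * (y - 2^-1 ^+ d.-1)| <= a * eps.
  apply: le_trans (ler_normD _ _) _; rewrite !normrM (ger0_norm (ltW b0)).
  rewrite (@ger0_norm _ (a - b)) ?subr_ge0 //.
  have := ler_wpM2l (ltW b0) r1; have := @ler_wpM2l _ (a - b) _ _ _ r2.
  by rewrite subr_ge0 => /(_ ba); lra.
move=> h; apply: (@le_trans _ _ (d%:R * (a * eps))).
  by apply: ler_pM => //; rewrite ler_nat leq_pred.
rewrite /eps /mean_err.
set z := (tau + 1 + d%:R) / n%:R; have z0 : 0 <= z by rewrite divr_ge0 ?addr_ge0.
have -> : d%:R * (a * (d%:R * (2 * (tau + 1 + d%:R) / n%:R))) = 2 * (a * d%:R ^+ 2 * z).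
  by rewrite /z; ring.
have : 0 <= a * d%:R ^+ 2 * z by apply: mulr_ge0 => //; rewrite mulr_ge0 ?exprn_ge0 ?(ltW inner_rate_gt0).
lra.
Qed.

(** The part of rate [b] over all edges at [v] reduces to the total spin, which is small by balance.
    Only the excess [a - b] on monochromatic edges survives, and there every other vertex carries
    the spin of [v]; this yields [beta]. *)
Lemma local_mean_spin v :
  `|\sum_(e : {set V} | v \in e) edge_prob e * vsum (spin R sigma) (e :\ v)
     - beta d a b * spin R sigma v| <= mean_err.
Proof.
rewrite edge_prob_split.
have t0 := tau_ge0.
have -> : \sum_(e : {set V} | [&& #|e| == d, v \in e & e \subset same_spin v]) vsum (spin R sigma) (e :\ v)
  = ('C(#|same_spin v|.-1, d.-1))%:R * ((d.-1)%:R * spin R sigma v).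
  rewrite -(@sum_edges_at _ v) ?inE //; apply: eq_bigr => e /and3P[/eqP ed ve es].
  rewrite /vsum (eq_bigr (fun _ => spin R sigma v)).
    rewrite sumr_const -[LHS]mulr_natl; congr (_%:R * _).
    by have := cardsD1 v e; rewrite ve ed => ->.
  move=> w; rewrite inE => /andP[_ we]; rewrite /spin.
  by have := fintype.subsetP es w we; rewrite inE => /eqP->.
have -> : \sum_(e : {set V} | [&& #|e| == d, v \in e & e \subset [set: V]]) vsum (spin R sigma) (e :\ v)
  = ('C(n - 2, d - 2))%:R * (\sum_j spin R sigma j - spin R sigma v).
  have -> : \sum_j spin R sigma j - spin R sigma v = \sum_(j | j != v) spin R sigma j.
    by rewrite (bigD1 v) //=; ring.
  rewrite mulr_sumr.
  under eq_bigr => e _ do rewrite /vsum big_mkcond /=.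
  rewrite exchange_big /= [RHS]big_mkcond /=; apply: eq_bigr => w _.
  case: (eqVneq w v) => [->|wv] /=.
    by rewrite big1 // => e _; rewrite !inE eqxx.
  rewrite eq_sym in wv.
  rewrite -(sum_edges_at2 _ wv) [RHS]big_mkcond [LHS]big_mkcond /=; apply: eq_bigr => e _.
  rewrite subsetT andbT !inE (eq_sym w) wv /=.
  by case: (_ == d); case: (v \in e); case: (w \in e).
have r2 := ratio_same v; set y := _ / N in r2.
have r3 := codeg_ratio; set z := _ / N in r3.
have z0 : 0 <= z by rewrite divr_ge0 // ltW.
set s := spin R sigma v; set S := \sum_j _.
have -> : b / N * (('C(n - 2, d - 2))%:R * (S - s))
   + (a - b) / N * (('C(#|same_spin v|.-1, d.-1))%:R * ((d.-1)%:R * s)) - beta d a b * s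
   = b * (z * (S - s)) + (a - b) * (d.-1%:R * (s * (y - 2^-1 ^+ d.-1))).
  rewrite /beta /z /y exprVn; field.
  by rewrite (gt_eqF binom_gt0) ?expf_neq0 ?pnatr_eq0.
have s1 : `|s| <= 1 := spin_norm v.
have h1 : `|z * (S - s)| <= d%:R / n%:R * (tau + 1).
  rewrite normrM (ger0_norm z0); apply: ler_pM => //.
  by apply: le_trans (ler_normB _ _) _; apply: lerD.
have h2 : `|d.-1%:R * (s * (y - 2^-1 ^+ d.-1))| <= d%:R * eps.
  rewrite normrM normr_nat; apply: ler_pM => //; first by rewrite ler_nat leq_pred.
  rewrite normrM; apply: le_trans r2; by rewrite ler_piMl.
apply: le_trans (ler_normD _ _) _; rewrite !(normrM b) !(normrM (a - b)) (ger0_norm (ltW b0)).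
rewrite (@ger0_norm _ (a - b)) ?subr_ge0 //.
have h1' := ler_wpM2l (ltW b0) h1; have := @ler_wpM2l _ (a - b) _ _ _ h2.
rewrite subr_ge0 => /(_ ba) h2'.
apply: le_trans (lerD h1' h2') _.
rewrite /eps /mean_err; set q := (tau + 1 + d%:R) / n%:R.
have q0 : 0 <= q by rewrite divr_ge0 ?addr_ge0.
have hq : d%:R / n%:R * (tau + 1) <= d%:R ^+ 2 * q.
  rewrite (_ : d%:R / n%:R * (tau + 1) = d%:R * ((tau + 1) / n%:R)); last by ring.
  rewrite expr2 -mulrA ler_wpM2l //; apply: (@le_trans _ _ q).
    by rewrite /q ler_pM2r ?invr_gt0 //; have := ler0n R d; lra.
  by rewrite ler_peMl // ler1n; clear -d3; lia.
have -> : d%:R * (d%:R * (2 * (tau + 1 + d%:R) / n%:R)) = 2 * (d%:R ^+ 2 * q) by rewrite /q; ring.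
have hb := ler_wpM2l (ltW b0) hq.
have dq0 : 0 <= d%:R ^+ 2 * q by rewrite mulr_ge0 ?exprn_ge0.
have := ler_wpM2r dq0 ba.
have -> : 3 * a * d%:R ^+ 2 * q = 3 * (a * (d%:R ^+ 2 * q)) by ring.
have := mulr_ge0 (ltW b0) dq0.
lra.
Qed.

End LocalMeans.

(** * Recurrences, spin balance, and the hypergraph law *)

Section Recurrence.
Variables (R : realFieldType) (x : nat -> R) (lam rho K : R) (l : nat).
Hypotheses (rho0 : 0 <= rho) (rl : rho < lam) (K0 : 0 <= K).
Hypothesis step : forall t, (t < l)%N -> `|x t.+1 - lam * x t| <= K * rho ^+ t.

Lemma lam_gt0 : 0 < lam. Proof. exact: le_lt_trans rl. Qed.

Lemma gap_gt0 : 0 < lam - rho. Proof. by rewrite subr_gt0. Qed.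

Lemma recurrence_growth t : (t <= l)%N ->
  `|x t| <= lam ^+ t * (`|x 0%N| + K / (lam - rho)).
Proof.
have g0 := gap_gt0; have l0 := lam_gt0.
(* The sharper bound solves [y t.+1 = lam * y t + K * rho ^+ t] exactly, so the induction closes
   with an equality. *)
move=> tl; apply: (@le_trans _ _ (lam ^+ t * `|x 0%N| + K * (lam ^+ t - rho ^+ t) / (lam - rho))).
  elim: t tl => [|t IH] tl; first by rewrite !expr0 subrr mulr0 mul0r mul1r addr0.
  have -> : x t.+1 = lam * x t + (x t.+1 - lam * x t) by ring.
  apply: le_trans (ler_normD _ _) _; rewrite normrM (gtr0_norm l0).
  have h := ler_wpM2l (ltW l0) (IH (ltnW tl)).
  apply: le_trans (lerD h (step tl)) _.
  rewrite le_eqVlt; apply/orP; left; apply/eqP; rewrite !exprS; field.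
  by rewrite gt_eqF.
rewrite [leRHS]mulrDr lerD2l [leRHS]mulrCA -mulrA ler_wpM2l // ler_pM2r ?invr_gt0 //.
by rewrite gerBl exprn_ge0.
Qed.

(** Telescoping: from [s] to [s + 1], the quantity [x s / lam ^+ (s - t)] moves by at most
    [K * rho ^+ s / lam ^+ (s - t).+1], a geometric series because [rho < lam]. *)
Lemma recurrence_backward t : (t <= l)%N ->
  `|x t - x l / lam ^+ (l - t)| <= K / (lam - rho) * rho ^+ t.
Proof.
have g0 := gap_gt0; have l0 := lam_gt0.
move=> tl; rewrite -{1}(subnKC tl); move: (leqnn (l - t)).
move: {1 3 4}(l - t)%N => j jl.
apply: (@le_trans _ _ (K / (lam - rho) * (rho ^+ t - rho ^+ (t + j) / lam ^+ j))); last first.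
  rewrite ler_wpM2l ?divr_ge0 ?(ltW g0) // gerBl divr_ge0 ?exprn_ge0 ?(ltW l0) //.
elim: j jl => [|j IH] jl.
  by rewrite addn0 expr0 !divr1 !subrr normr0 mulr0.
have tjl : (t + j < l)%N by lia.
have {}IH := IH (ltnW jl).
have lj : 0 < lam ^+ j by rewrite exprn_gt0.
rewrite addnS (_ : x t - _ = (x t - x (t + j)%N / lam ^+ j)
   - (x (t + j).+1 - lam * x (t + j)%N) / lam ^+ j.+1); last first.
  by rewrite !exprS; field; rewrite !gt_eqF.
apply: le_trans (ler_normB _ _) _; rewrite normrM normfV (@gtr0_norm _ (lam ^+ j.+1)) ?exprn_gt0 //.
have h := step tjl.
rewrite -(@ler_pM2r _ (lam ^+ j.+1)^-1) ?invr_gt0 ?exprn_gt0 // in h.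
apply: le_trans (lerD IH h) _.
rewrite le_eqVlt; apply/orP; left; apply/eqP; rewrite !exprS; field.
by rewrite !gt_eqF.
Qed.

End Recurrence.

Section SpinBalance.
Variables (R : realType) (n : nat).

(** By independence the sum factors over vertices, and [expR_le_quad] at [theta] and [- theta]
    bounds each factor by [2 + 4 theta^2]. *)
Lemma spin_mgf (theta : R) : `|theta| <= 1 / 2 ->
  \sum_(sigma : {ffun 'I_n -> bool}) expR (theta * \sum_j spin R sigma j)
    <= 2 ^+ n * expR (2 * n%:R * theta ^+ 2).
Proof.
move=> th.
have -> : \sum_(sigma : {ffun 'I_n -> bool}) expR (theta * \sum_j spin R sigma j)
   = \prod_(j < n) \sum_(s : bool) expR (theta * (if s then 1 else -1)).
  rewrite bigA_distr_bigA; apply: eq_bigr => sigma _.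
  by rewrite mulr_sumr expR_sum.
rewrite prodr_const card_ord.
have -> : 2 ^+ n * expR (2 * n%:R * theta ^+ 2) = (2 * expR (2 * theta ^+ 2)) ^+ n.
  by rewrite exprMn -expRM_natl; congr (_ * expR _); ring.
apply: lerXn2r; rewrite ?nnegrE ?mulr_ge0 ?expR_ge0 //.
  by apply: sumr_ge0 => s _; apply: expR_ge0.
rewrite big_bool /= mulr1 mulrN1.
have h1 : theta <= 1 / 2 := le_trans (ler_norm _) th.
have h2 : - theta <= 1 / 2 by apply: le_trans (ler_norm _) _; rewrite normrN.
have e1 := expR_le_quad h1; have e2 := expR_le_quad h2.
have := expR_ge1Dx (2 * theta ^+ 2).
rewrite sqrrN in e2; lra.
Qed.

(** With tilt [1 / sqrt n] the exponential moment is at most [expR 2], while the threshold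
    contributes [expR (- L) = 1 / n]. The 2 counts both tails, and [4 <= n] keeps the tilt below
    [1 / 2]. *)
Lemma unbalanced_prob (L : R) : (4 <= n)%N -> n%:R = expR L :> R ->
  (2 ^+ n)^-1 * \sum_(sigma : {ffun 'I_n -> bool})
     (Num.sqrt n%:R * L < `|\sum_j spin R sigma j|)%R%:R
  <= 2 * expR (2 : R) / n%:R.
Proof.
move=> n4 nL.
have n0 : 0 < n%:R :> R by rewrite nL expR_gt0.
have sq0 : 0 < Num.sqrt (n%:R : R) by rewrite sqrtr_gt0.
have sqn : Num.sqrt (n%:R : R) ^+ 2 = n%:R by rewrite sqr_sqrtr // ltW.
set th := (Num.sqrt (n%:R : R))^-1.
have th0 : 0 < th by rewrite invr_gt0.
have th2 : th <= 1 / 2.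
  rewrite div1r lef_pV2 ?posrE // -(@ler_pXn2r _ 2) ?nnegrE // ?(ltW sq0) // sqn -natrX ler_nat //.
have one (s : R) : `|s| <= th -> s ^+ 2 = th ^+ 2 ->
    \sum_(sigma : {ffun 'I_n -> bool}) expR (s * \sum_j spin R sigma j) <= 2 ^+ n * expR 2.
  move=> s1 s2; apply: le_trans (spin_mgf (le_trans s1 th2)) _.
  by rewrite s2 /th exprVn sqn mulfK // gt_eqF.
have p2 : 0 < 2 ^+ n :> R by rewrite exprn_gt0.
rewrite ler_pdivrMl //.
apply: (@le_trans _ _ (\sum_(sigma : {ffun 'I_n -> bool})
   (expR (- L) * (expR (th * \sum_j spin R sigma j) + expR (- th * \sum_j spin R sigma j))))).
  apply: ler_sum => sigma _; case: (boolP (_ < _)) => [lt|_]; last first.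
    by rewrite mulr_ge0 ?addr_ge0 ?expR_ge0.
  rewrite mulrDr -!expRD /=.
  have {}lt : L < th * `|\sum_j spin R sigma j| by rewrite /th ltr_pdivlMl.
  have [e|e] : `|\sum_j spin R sigma j| = \sum_j spin R sigma j \/
    `|\sum_j spin R sigma j| = - \sum_j spin R sigma j.
    by case: (lerP 0 (\sum_j spin R sigma j)) => h; [left; rewrite ger0_norm|right; rewrite ltr0_norm].
  - have : 1 <= expR (- L + th * \sum_j spin R sigma j).
      by rewrite -[leLHS]expR0 ler_expR; rewrite e in lt; lra.
    have := expR_ge0 (- L + - th * \sum_j spin R sigma j); lra.
  - have : 1 <= expR (- L + - th * \sum_j spin R sigma j).
      by rewrite -[leLHS]expR0 ler_expR; rewrite e in lt; lra.
    have := expR_ge0 (- L + th * \sum_j spin R sigma j); lra.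
rewrite -mulr_sumr big_split /= expRN -nL.
have h1 := one th; have h2 := one (- th).
rewrite normrN sqrrN (gtr0_norm th0) lexx in h1 h2.
have := lerD (h1 isT erefl) (h2 isT erefl) => h.
apply: le_trans (ler_wpM2l _ h) _; first by rewrite invr_ge0 ltW.
by rewrite le_eqVlt; apply/orP; left; apply/eqP; ring.
Qed.

End SpinBalance.

Section HypergraphProbability.
Variables (R : realType) (n d : nat) (a b : R).
Notation V := 'I_n.
Implicit Types (sigma : {ffun V -> bool}) (H : {set {set V}}).

Lemma hsbm_probE (E : {ffun V -> bool} -> {set {set V}} -> bool) :
  hsbm_prob d (pn n d a) (pn n d b) E
  = (2 ^+ n)^-1 * \sum_sigma
      bern_expect (edge_prob d a b sigma) (fun H => ((H \subset dsets n d) && E sigma H)%:R).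
Proof.
rewrite /hsbm_prob mulr_sumr; apply: eq_bigr => sigma _.
rewrite /bern_expect mulr_sumr big_mkcond /=; apply: eq_bigr => H _.
case: (boolP (H \subset dsets n d)) => [/fintype.subsetP Hd|_] /=; last by rewrite !mulr0.
case: (E sigma H); last by rewrite !mulr0.
rewrite mulr1 /hsbm_weight /bern_weight; congr (_ * _).
rewrite [LHS]big_mkcond /=; apply: eq_bigr => e _.
rewrite /edge_prob inE; case: ifP => //= ed.
by rewrite ifF ?subr0 //; apply/negP => /Hd; rewrite inE ed.
Qed.

Lemma bern_expect_dsets sigma (f g : {set {set V}} -> R) :
  (forall e : {set V}, 0 <= edge_prob d a b sigma e <= 1) ->
  (forall H, H \subset dsets n d -> f H <= g H) ->
  bern_expect (edge_prob d a b sigma) f <= bern_expect (edge_prob d a b sigma) g.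
Proof.
move=> p01 fg; apply: ler_sum => H _.
case: (boolP (H \subset dsets n d)) => [Hd|/subsetPn[e eH ed]].
  by apply: ler_wpM2l; [apply: bern_weight_ge0|apply: fg].
rewrite /bern_weight (bigD1 e) //= eH /edge_prob.
by rewrite inE in ed; rewrite (negbTE ed) !mul0r.
Qed.

End HypergraphProbability.

(** The cubic Taylor term is [(L / 4)^3 / 3! = L^3 / 384]. *)
Lemma expR_quarter_ge (R : realType) (c L : R) : 0 <= c -> 384 * c <= L ->
  c * L ^+ 2 <= expR (L / 4).
Proof.
move=> c0 cL; have L0 : 0 <= L by apply: le_trans cL; rewrite mulr_ge0.
apply: le_trans (expR_ge1Dxn 2 (_ : 0 <= L / 4)); last by rewrite divr_ge0.
have := ler_wpM2r (sqr_ge0 L) cL.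
rewrite (_ : (3`!)%:R = 6 :> R) // expr_div_n.
have -> : L ^+ 3 / 4 ^+ 3 / 6 = (L * L ^+ 2) / 384 by field.
lra.
Qed.

(** * Control of all layers *)

Section TypicalExploration.
Variables (R : realType) (n d : nat) (a b tau m L Q : R) (l : nat).
Variable sigma : {ffun 'I_n -> bool}.
Notation V := 'I_n.
Implicit Types (U A : {set V}) (H : {set {set V}}).

Notation al := (alpha d a b).
Notation be := (beta d a b).
Let kappa : R := a * d%:R / n%:R.
Let rho : R := Num.sqrt al.
Definition dev_const : R := 2 * d%:R * Q * (a + 3).
Notation K := dev_const.

Hypotheses (d3 : (3 <= d)%N) (dn : (2 * d <= n)%N) (b0 : 0 < b) (ba : b <= a).
Hypotheses (al1 : 1 < al) (L1 : 1 <= L) (Q1 : 1 <= Q).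
Hypothesis balanced : `|\sum_j spin R sigma j| <= tau.
Hypothesis sparse : a / ('C(n, d.-1))%:R <= 1.
Hypothesis mean_small :
  mean_err n d a tau * m + 2 * d%:R ^+ 2 * (kappa * m * (2 * m)) <= 1.
Hypothesis kappa_m : kappa * m <= 1 / 2.
Hypothesis overlap_small : kappa * m * (2 * (al * m + K * L * rho ^+ l + 1)) <= 1.

Definition weight (f : bool) : V -> R := if f then spin R sigma else fun _ => 1.
Definition growth (f : bool) : R := if f then be else al.
(* This tilt balances the linear term [theta * K L rho^t = (a + 3) L] against the
   quadratic one [2 (theta d)^2 a |A| <= a L / 2], leaving [exp (- 3 L) = n^-3]. *)
Definition tilt (t : nat) (s : bool) : R := (-1) ^+ s * (2 * d%:R * Q * rho ^+ t)^-1.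

Definition deviates t (f s : bool) A A' : bool :=
  `|tilt t s| * (K * L * rho ^+ t + 1 + kappa * #|A|%:R * #|A'|%:R)
  < tilt t s * (vsum (weight f) A' - growth f * vsum (weight f) A).

Definition step_pre t U A : bool :=
  [&& A \subset U, #|A|%:R <= Q ^+ 2 * L * al ^+ t, #|A|%:R <= m & #|~: U|%:R <= m].

(* The precondition is part of the bad event so that its probability is small for
   every [U] and [A]; [layer_pre] shows that it never fails before a bad step. *)
Definition step_bad t U A A' : bool :=
  step_pre t U A && [exists f : bool, exists s : bool, deviates t f s A A'].

Lemma a_gt0 : 0 < a. Proof. exact: lt_le_trans ba. Qed.
Lemma d_ge1 : 1 <= d%:R :> R. Proof. by rewrite ler1n; clear -d3; lia. Qed.
Lemma n_pos : 0 < n%:R :> R. Proof. by rewrite ltr0n; clear -d3 dn; lia. Qed.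
Lemma kappa_ge0 : 0 <= kappa. Proof. by rewrite divr_ge0 ?mulr_ge0 ?(ltW a_gt0). Qed.
Lemma rho_ge1 : 1 <= rho. Proof. by rewrite -sqrtr1 ler_wsqrtr // ltW. Qed.
Lemma rho2 : rho ^+ 2 = al. Proof. by rewrite /rho sqr_sqrtr // ltW // (lt_trans ltr01). Qed.
Lemma rho_t t : 1 <= rho ^+ t. Proof. exact: exprn_ege1 rho_ge1. Qed.

Lemma al_gt0 : 0 < al. Proof. exact: lt_trans al1. Qed.
Lemma Q_gt0 : 0 < Q. Proof. exact: lt_le_trans Q1. Qed.
Lemma L_gt0 : 0 < L. Proof. exact: lt_le_trans L1. Qed.
Lemma rho_gt0 : 0 < rho. Proof. exact: lt_le_trans rho_ge1. Qed.
Lemma d_gt0 : 0 < d%:R :> R. Proof. exact: lt_le_trans d_ge1. Qed.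
Local Hint Resolve a_gt0 d_ge1 n_pos kappa_ge0 rho_ge1 rho_t al_gt0 Q_gt0 L_gt0 rho_gt0 d_gt0 : core.
Lemma a_ge0 : 0 <= a. Proof. exact: ltW. Qed.
Lemma al_ge0 : 0 <= al. Proof. exact: ltW. Qed.
Lemma Q_ge0 : 0 <= Q. Proof. exact: ltW. Qed.
Lemma L_ge0 : 0 <= L. Proof. exact: ltW. Qed.
Lemma rho_ge0 : 0 <= rho. Proof. exact: ltW. Qed.
Local Hint Resolve a_ge0 al_ge0 Q_ge0 L_ge0 rho_ge0 : core.
Lemma K_ge0 : 0 <= K. Proof. by rewrite !mulr_ge0 ?addr_ge0. Qed.
Local Hint Resolve K_ge0 : core.

Lemma weight_norm f v : `|weight f v| <= 1.
Proof. by case: f; rewrite /weight ?normr1 // spin_norm. Qed.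

Lemma norm_tilt t s : `|tilt t s| = (2 * d%:R * Q * rho ^+ t)^-1.
Proof.
rewrite normrM normrX normrN1 expr1n mul1r ger0_norm // invr_ge0.
by rewrite !mulr_ge0 ?exprn_ge0.
Qed.

Lemma step_mean t U A f : step_pre t U A ->
  `|\sum_(e in frontier_edges d U A) edge_prob d a b sigma e * vsum (weight f) (e :\: A)
     - growth f * vsum (weight f) A| <= 1.
Proof.
case/and4P=> AU _ Am Um; have m0 : 0 <= m := le_trans (ler0n _ _) Am.
apply: le_trans (layer_mean (kappa := kappa) (delta := mean_err n d a tau) _ _ _ AU _ _ _) _ => //.
- by move=> e; apply: edge_prob_ge0.
- by move=> e; apply: edge_prob_supp.
- by move=> v w; apply: edge_prob_codeg.
- exact: weight_norm.
- by case: f => v; [apply: local_mean_spin|apply: local_mean_card].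
apply: le_trans mean_small; apply: lerD.
  rewrite ler_wpM2l // /mean_err !mulr_ge0 ?exprn_ge0 ?invr_ge0 ?(ltW n_pos) ?(ltW a_gt0) //.
  by rewrite !addr_ge0 // (tau_ge0 balanced).
rewrite ler_wpM2l ?mulr_ge0 ?exprn_ge0 //.
rewrite ler_pM ?mulr_ge0 // ?ler_wpM2l //.
apply: (@le_trans _ _ (#|A|%:R + #|~: U|%:R)); last by lra.
by rewrite -natrD ler_nat cardsU leq_subr.
Qed.

(** The 4 is a union bound over two weights and two tails. *)
Lemma step_bad_prob t U A :
  bern_expect (edge_prob d a b sigma) (fun H => (step_bad t U A (next_layer d U A H))%:R)
  <= 4 * expR (- 3 * L).
Proof.
have p0 e : 0 <= edge_prob d a b sigma e by apply: edge_prob_ge0.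
have p1 e : edge_prob d a b sigma e <= 1 by apply: le_trans sparse; apply: edge_prob_le.
have p01 e : 0 <= edge_prob d a b sigma e <= 1 by rewrite p0 p1.
case: (boolP (step_pre t U A)) => [pre|npre]; last first.
  rewrite /step_bad (negbTE npre) /bern_expect big1 ?mulr_ge0 ?expR_ge0 // => H _.
  by rewrite mulr0.
apply: (@le_trans _ _ (bern_expect (edge_prob d a b sigma) (fun H =>
   \sum_(f : bool) \sum_(s : bool) (deviates t f s A (next_layer d U A H))%:R))).
  apply: ler_bern_expect => // H; rewrite /step_bad pre /=.
  case: existsP => [[f /existsP[s fs]]|_]; last by do 2!apply: sumr_ge0 => ? _.
  rewrite (bigD1 f) //= (bigD1 s) //= fs -addrA lerDl.
  by apply: addr_ge0; [|apply: sumr_ge0 => ? _]; apply: sumr_ge0.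
rewrite bern_expect_sum; under eq_bigr do rewrite bern_expect_sum.
have one f s : bern_expect (edge_prob d a b sigma) (fun H =>
    (deviates t f s A (next_layer d U A H))%:R) <= expR (- 3 * L).
  have r1 := rho_t t.
  have den : 0 < 2 * d%:R * Q * rho ^+ t by rewrite !mulr_gt0 //; lra.
  (* The factor [2 d] in [tilt] serves this condition, which the quadratic bound on the exponential
     requires. *)
  have small : `|tilt t s| * d%:R <= 1 / 2.
    rewrite norm_tilt ler_pdivrMl //.
    rewrite (_ : _ * (1 / 2) = d%:R * (Q * rho ^+ t)); last by field.
    by rewrite ler_peMr ?mulr_ege1.
  have tail := layer_tail (d := d) p0 (edge_prob_deg sigma d3 dn b0 ba)
    (edge_prob_codeg sigma d3 dn b0 ba) (K * L * rho ^+ t) p1 kappa_ge0 (weight_norm f)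
    small (step_mean f pre).
  apply: le_trans tail _.
  rewrite ler_expR exprMn -[tilt t s ^+ 2]real_normK ?num_real // norm_tilt.
  case/and4P: pre => _ A2 _ _.
  have q0 : Q != 0 by rewrite gt_eqF //; lra.
  have r0 : rho ^+ t != 0 by rewrite gt_eqF //; lra.
  have dd0 : d%:R != 0 :> R by rewrite gt_eqF //; lra.
  have -> : (2 * d%:R * Q * rho ^+ t)^-1 * (K * L * rho ^+ t) = (a + 3) * L.
    by rewrite /dev_const; field; rewrite q0 r0 dd0.
  have e2 : 2 * ((2 * d%:R * Q * rho ^+ t)^-1 ^+ 2 * d%:R ^+ 2) * (a * (Q ^+ 2 * L * al ^+ t))
     = a * L / 2.
    by rewrite -rho2 -exprM mulnC exprM; field; rewrite q0 r0 dd0.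
  have : 2 * ((2 * d%:R * Q * rho ^+ t)^-1 ^+ 2 * d%:R ^+ 2) * (a * #|A|%:R) <= a * L / 2.
    rewrite -e2 ler_wpM2l ?mulr_ge0 ?exprn_ge0 ?invr_ge0 ?(ltW den) //.
    by rewrite ler_wpM2l // ltW.
  have : 0 <= a * L by rewrite mulr_ge0 ?(ltW a_gt0) //; lra.
  lra.
by rewrite !big_bool /=; have := one true true; have := one true false;
  have := one false true; have := one false false; lra.
Qed.

(** The random overlap term is removed here. The case [f = false] bounds [|A'|] by a deterministic
    quantity plus half of itself, thanks to [kappa_m]; the half is absorbed. Then [overlap_small]
    makes the overlap at most 1, and the two leftover units fit into [2 * L * rho ^+ t]. *)
Lemma step_ok t U A A' f : step_pre t U A -> (t <= l)%N -> ~~ step_bad t U A A' ->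
  `|vsum (weight f) A' - growth f * vsum (weight f) A| <= (K + 2) * L * rho ^+ t.
Proof.
move=> pre tl; rewrite /step_bad pre /= => /existsPn nb.
have r1 := rho_t t.
have den : 0 < (2 * d%:R * Q * rho ^+ t)^-1 by rewrite invr_gt0 !mulr_gt0 //; lra.
have K0 := K_ge0.
have dev g : `|vsum (weight g) A' - growth g * vsum (weight g) A|
    <= K * L * rho ^+ t + 1 + kappa * #|A|%:R * #|A'|%:R.
  have /existsPn nbg := nb g.
  have := nbg true; have := nbg false; rewrite /deviates -!leNgt !norm_tilt /tilt.
  rewrite expr0 expr1 mul1r mulN1r mulNr -mulrN !(ler_pM2l den).
  by rewrite ler_norml; lra.
case/and4P: pre => _ _ Am _.
have m0 : 0 <= m := le_trans (ler0n _ _) Am.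
have kA : kappa * #|A|%:R <= kappa * m by rewrite ler_wpM2l.
have sl : K * L * rho ^+ t <= K * L * rho ^+ l.
  by apply: ler_wpM2l; [rewrite mulr_ge0|rewrite ler_weXn2l].
have A'le : #|A'|%:R <= 2 * (al * m + K * L * rho ^+ l + 1).
  have := dev false; rewrite /= !vsum1 ler_norml => /andP[_].
  have : kappa * #|A|%:R * #|A'|%:R <= 1 / 2 * #|A'|%:R.
    by rewrite ler_wpM2r //; apply: le_trans kappa_m.
  have : al * #|A|%:R <= al * m by rewrite ler_wpM2l //; lra.
  by lra.
apply: le_trans (dev f) _.
have : kappa * #|A|%:R * #|A'|%:R <= 1.
  apply: le_trans overlap_small; apply: ler_pM => //.
  by rewrite mulr_ge0.
have : 1 <= L * rho ^+ t by rewrite mulr_ege1.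
rewrite mulrDl mulrDl -!mulrA; lra.
Qed.

Section Layers.
Hypothesis be_gt : al < be ^+ 2.
Hypothesis Q_large : 1 + (K + 2) / (al - rho) <= Q ^+ 2.
Hypothesis room : Q ^+ 2 * L * al ^+ l <= m.
Hypothesis room_ball : Q ^+ 2 * L * al ^+ l / (al - 1) <= m.
Variables (H : {set {set V}}) (i : V).
Hypothesis Hd : H \subset dsets n d.
Hypothesis not_bad : ~~ explore_bad d step_bad l 0 [set: V] [set i] H.

Lemma Vt0 : Vt H 0 i = [set i].
Proof. by apply/setP => x; rewrite mem_Vt /Vlt big_ord0 !inE andbT. Qed.

Lemma al_rho : rho < al.
Proof.
rewrite -rho2 expr2 ltr_pMr; last by have := rho_ge1; lra.
by rewrite -sqrtr1 ltr_sqrt //; lra.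
Qed.

Lemma be_rho : rho < be.
Proof.
have be0 : 0 <= be by rewrite /beta divr_ge0 ?exprn_ge0 // mulr_ge0 // subr_ge0.
by rewrite -(@ltr_pXn2r _ 2) ?nnegrE // ?rho2 //; have := rho_ge1; lra.
Qed.

Lemma K2_ge0 : 0 <= (K + 2) * L.
Proof.
have K0 := K_ge0.
by rewrite mulr_ge0 //; lra.
Qed.

Lemma layer_pre t : (t <= l)%N ->
  (forall s, (s <= t)%N -> #|Vt H s i|%:R <= Q ^+ 2 * L * al ^+ s) ->
  step_pre t (~: Vlt H t i) (Vt H t i).
Proof.
move=> tl hs.
have QL : 0 <= Q ^+ 2 * L by rewrite mulr_ge0 ?exprn_ge0 //; lra.
have mon s : (s <= l)%N -> Q ^+ 2 * L * al ^+ s <= Q ^+ 2 * L * al ^+ l.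
  by move=> sl; rewrite ler_wpM2l // ler_weXn2l // ltW.
(* The bound reproduces itself: adding a layer [al ^+ s] to [al ^+ s / (al - 1)] gives
   [al ^+ s.+1 / (al - 1)]. *)
have ballb s : (s <= t)%N -> #|Vlt H s i|%:R <= Q ^+ 2 * L * al ^+ s / (al - 1).
  have g0 : 0 < al - 1 by rewrite subr_gt0.
  elim: s => [|s IH] st.
    by rewrite /Vlt big_ord0 cards0 divr_ge0 ?mulr_ge0 ?exprn_ge0 ?(ltW g0) //; lra.
  rewrite VltS; apply: (@le_trans _ _ (#|Vlt H s i|%:R + #|Vt H s i|%:R)).
    by rewrite -natrD ler_nat cardsU leq_subr.
  apply: le_trans (lerD (IH (ltnW st)) (hs _ (ltnW st))) _.
  rewrite le_eqVlt; apply/orP; left; apply/eqP; rewrite (exprS al); field.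
  by rewrite gt_eqF.
apply/and4P; split.
- by apply/fintype.subsetP => x; rewrite mem_Vt inE => /andP[].
- exact: hs.
- by apply: le_trans (hs t (leqnn t)) _; apply: le_trans (mon t tl) room.
- rewrite setCK; apply: le_trans (ballb t (leqnn t)) _; apply: le_trans room_ball.
  by rewrite ler_pM2r ?invr_gt0 ?subr_gt0 // mon.
Qed.

Lemma layer_step f t : (t < l)%N ->
  (forall s, (s <= t)%N -> #|Vt H s i|%:R <= Q ^+ 2 * L * al ^+ s) ->
  `|vsum (weight f) (Vt H t.+1 i) - growth f * vsum (weight f) (Vt H t i)|
    <= (K + 2) * L * rho ^+ t.
Proof.
move=> tl hs; apply: (step_ok f (layer_pre (ltnW tl) hs) (ltnW tl)).
exact: (explore_badN Hd not_bad).
Qed.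

(** The bootstrap. Size bounds up to level [t] validate all steps up to [t], and [recurrence_growth]
    with horizon [t.+1], not [l], returns the bound at [t.+1] through [Q_large]. *)
Lemma layer_card_le t : (t <= l)%N -> #|Vt H t i|%:R <= Q ^+ 2 * L * al ^+ t.
Proof.
suff: forall s, (s <= t)%N -> (s <= l)%N -> #|Vt H s i|%:R <= Q ^+ 2 * L * al ^+ s.
  by move=> h tl; apply: h.
elim: t => [|t IH] s.
  rewrite leqn0 => /eqP-> _; rewrite Vt0 cards1 mulr1.
  by rewrite mulr_ege1 // exprn_ege1.
rewrite leq_eqVlt => /orP[/eqP->|st] tl; last exact: IH.
have := @recurrence_growth _ (fun t => vsum (weight false) (Vt H t i)) al rho ((K + 2) * L) t.+1.
move=> /(_ (sqrtr_ge0 _) al_rho K2_ge0 _ t.+1 (leqnn _)).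
rewrite !vsum1 Vt0 cards1 normr1 normr_nat => h.
apply: le_trans (h _) _.
  move=> s' s't; apply: (layer_step false) (leq_trans s't tl) _ => s'' s''s.
  by apply: IH; [apply: leq_trans s''s _|apply: ltnW; apply: leq_trans tl; apply: leq_ltn_trans s''s _].
rewrite mulrC ler_wpM2r ?exprn_ge0 //.
apply: (@le_trans _ _ ((1 + (K + 2) / (al - rho)) * L)); last by rewrite ler_wpM2r.
by rewrite [leRHS]mulrDl mul1r lerD // mulrAC.
Qed.

Definition good_const : R := Q ^+ 2 + 1 + (K + 2) / (al - rho) + (K + 2) / (be - rho).

Lemma layers_good t : (t <= l)%N ->
  [&& St R H t i <= good_const * L * al ^+ t,
      `|Dt R sigma H t i| <= good_const * L * be ^+ t,
      `|St R H t i - St R H l i / al ^+ (l - t)| <= good_const * L * rho ^+ t &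
      `|Dt R sigma H t i - Dt R sigma H l i / be ^+ (l - t)| <= good_const * L * rho ^+ t].
Proof.
move=> tl; have stepf f s : (s < l)%N ->
    `|vsum (weight f) (Vt H s.+1 i) - growth f * vsum (weight f) (Vt H s i)|
      <= (K + 2) * L * rho ^+ s.
  move=> sl; apply: (layer_step f sl) => s' s's; apply: layer_card_le.
  by apply: leq_trans s's (ltnW sl).
have KL := K2_ge0.
have K0 : 0 <= K + 2 by rewrite -(@pmulr_lge0 _ L).
have G1 : 0 <= (K + 2) / (al - rho) by rewrite divr_ge0 // subr_ge0 ltW // al_rho.
have G2 : 0 <= (K + 2) / (be - rho) by rewrite divr_ge0 // subr_ge0 ltW // be_rho.
have Q0 : 0 <= Q ^+ 2 by rewrite sqr_ge0.
have le_good c x : 0 <= x -> c <= good_const -> c * L * x <= good_const * L * x.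
  by move=> x0 cg; rewrite !ler_wpM2r.
have r0 : 0 <= rho ^+ t by rewrite exprn_ge0 // sqrtr_ge0.
have eD s : Dt R sigma H s i = vsum (weight true) (Vt H s i) by [].
have eS s : St R H s i = vsum (weight false) (Vt H s i) by rewrite vsum1.
have rc : (K + 2) * L / (al - rho) = (K + 2) / (al - rho) * L by rewrite mulrAC.
have rd : (K + 2) * L / (be - rho) = (K + 2) / (be - rho) * L by rewrite mulrAC.
apply/and4P; split.
- apply: le_trans (layer_card_le tl) _; apply: le_good; first by rewrite exprn_ge0.
  by rewrite /good_const; lra.
- rewrite eD.
  have := @recurrence_growth _ (fun s => vsum (weight true) (Vt H s i)) be rho ((K + 2) * L) l.
  move=> /(_ (sqrtr_ge0 _) be_rho KL (stepf true) t tl) h; apply: le_trans h _.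
  have be0 : 0 <= be ^+ t.
    by rewrite exprn_ge0 //; have := be_rho; have := rho_ge1; lra.
  rewrite mulrC; apply: (@le_trans _ _ ((1 + (K + 2) / (be - rho)) * L * be ^+ t)).
    rewrite ler_wpM2r // rd [leRHS]mulrDl mul1r lerD2r.
    rewrite /= Vt0 /vsum big_set1; apply: le_trans L1; exact: (weight_norm true).
  by apply: le_good => //; rewrite /good_const; lra.
- rewrite !eS.
  have := @recurrence_backward _ (fun s => vsum (weight false) (Vt H s i)) al rho ((K + 2) * L) l.
  move=> /(_ (sqrtr_ge0 _) al_rho KL (stepf false) t tl) h; apply: le_trans h _.
  by rewrite rc; apply: le_good => //; rewrite /good_const; lra.
- rewrite !eD.
  have := @recurrence_backward _ (fun s => vsum (weight true) (Vt H s i)) be rho ((K + 2) * L) l.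
  move=> /(_ (sqrtr_ge0 _) be_rho KL (stepf true) t tl) h; apply: le_trans h _.
  by rewrite rd; apply: le_good => //; rewrite /good_const; lra.
Qed.

End Layers.
End TypicalExploration.

(** * Union bound over roots, and numerical conditions for large n *)

Lemma good_event_prob (R : realType) (n d : nat) (a b m L Q : R) (l : nat) :
  (3 <= d)%N -> (2 * d <= n)%N -> 0 < b -> b <= a -> 1 < alpha d a b ->
  alpha d a b < beta d a b ^+ 2 -> 1 <= L -> 1 <= Q -> (4 <= n)%N ->
  n%:R = expR L -> a / ('C(n, d.-1))%:R <= 1 ->
  mean_err n d a (Num.sqrt n%:R * L) * m
    + 2 * d%:R ^+ 2 * (a * d%:R / n%:R * m * (2 * m)) <= 1 ->
  a * d%:R / n%:R * m <= 1 / 2 ->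
  a * d%:R / n%:R * m * (2 * (alpha d a b * m
     + dev_const d a Q * L * Num.sqrt (alpha d a b) ^+ l + 1)) <= 1 ->
  1 + (dev_const d a Q + 2) / (alpha d a b - Num.sqrt (alpha d a b)) <= Q ^+ 2 ->
  Q ^+ 2 * L * alpha d a b ^+ l <= m ->
  Q ^+ 2 * L * alpha d a b ^+ l / (alpha d a b - 1) <= m ->
  1 - (2 * expR (2 : R) / n%:R + n%:R * (l%:R * (4 * expR (- 3 * L))))
  <= hsbm_prob d (pn n d a) (pn n d b) (good_event n d a b (good_const d a b Q) l).
Proof.
move=> d3 dn b0 ba al1 be_gt L1 Q1 n4 nL sparse mean_small kappa_m overlap Q_large room room_b.
rewrite hsbm_probE.
set tau := Num.sqrt n%:R * L; set eps := l%:R * (4 * expR (- 3 * L)).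
have eps0 : 0 <= eps by rewrite !mulr_ge0 ?expR_ge0.
set unbal := fun sigma : {ffun 'I_n -> bool} => tau < `|\sum_j spin R sigma j|.
have p2 : 0 < 2 ^+ n :> R by rewrite exprn_gt0.
(* The bound is proved for each [sigma] separately; for an unbalanced one the bracket is at most 0
   and nothing has to be shown. *)
apply: (@le_trans _ _ ((2 ^+ n)^-1 * \sum_(sigma : {ffun 'I_n -> bool})
   (1 - ((unbal sigma)%:R + n%:R * eps)))).
  rewrite sumrB big_split /= !sumr_const card_ffun card_bool card_ord.
  rewrite -(mulr_natl 1 (2 ^ n)) -(mulr_natl (n%:R * eps) (2 ^ n)) natrX.
  rewrite (_ : _^-1 * _ = 1 - ((2 ^+ n)^-1 * \sum_(sigma : {ffun 'I_n -> bool}) (unbal sigma)%:R + n%:R * eps)).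
    by rewrite lerD2l lerN2 lerD2r; apply: unbalanced_prob.
  by field; rewrite gt_eqF.
rewrite ler_pM2l ?invr_gt0 //; apply: ler_sum => sigma _.
have p01 (e : {set 'I_n}) : 0 <= edge_prob d a b sigma e <= 1.
  by rewrite edge_prob_ge0 //=; apply: le_trans sparse; apply: edge_prob_le.
case: (boolP (unbal sigma)) => [_|].
  apply: (@le_trans _ _ 0); last exact: bern_expect_ge0.
  have : 0 <= n%:R * eps by rewrite mulr_ge0.
  by rewrite /=; lra.
rewrite /unbal -leNgt => bal; rewrite add0r.
set bad := fun i H => explore_bad d (step_bad d a b m L Q sigma) l 0 [set: 'I_n] [set i] H.
apply: (@le_trans _ _ (bern_expect (edge_prob d a b sigma)
   (fun H => 1 + (-1) * \sum_i (bad i H)%:R))); last first.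
  apply: bern_expect_dsets => // H Hd; rewrite Hd /=.
  case: (boolP (good_event _ _ _ _ _ _ _ _)) => [_|ng].
    by rewrite mulN1r gerBl; apply: sumr_ge0.
  have [i bi] : exists i, bad i H.
    apply/existsP; apply: contraR ng; rewrite negb_exists => /forallP nb.
    apply/forallP => i; apply/forallP => t; apply/implyP => _.
    rewrite nL expRK.
    apply: (layers_good d3 b0 ba al1 L1 Q1 kappa_m overlap be_gt Q_large room room_b Hd (nb i)).
    by rewrite -ltnS.
  rewrite mulN1r subr_le0 (bigD1 i) //= bi lerDl; exact: sumr_ge0.
rewrite bern_expectD bern_expect1 bern_expectZ bern_expect_sum mulN1r lerD2l lerN2.
apply: (@le_trans _ _ (\sum_(i < n) eps)); last first.
  by rewrite sumr_const card_ord mulr_natl.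
apply: ler_sum => i _; rewrite /eps; apply: explore_bad_expect => //.
exact: (step_bad_prob d3 dn b0 ba al1 L1 Q1 bal sparse mean_small).
Qed.

(** The summands pay in turn for the overlap with the next layer, the local mean error, collisions
    in the layer mean, [kappa * m <= 1 / 2], and the bounds of [n] below by [a * D], [2 * D] and
    4. *)
Definition size_const (R : realType) (a D M K al : R) : R :=
  2 * a * D * M * (al * M + K + 1) + 6 * a * D ^+ 2 * (2 + D) * M
  + 8 * a * D ^+ 3 * M ^+ 2 + 2 * a * D * M + a * D + 2 * D + 4.

Lemma size_const_ge4 (R : realType) (a D M K al : R) :
  0 <= a -> 0 <= D -> 0 <= M -> 0 <= K -> 0 <= al -> 4 <= size_const a D M K al.
Proof.
move=> a0 D0 M0 K0 al0; rewrite /size_const -[leLHS]add0r lerD2r.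
by rewrite !addr_ge0 // !mulr_ge0 ?exprn_ge0 ?addr_ge0 ?mulr_ge0.
Qed.

(* All error terms are [O(L^2 / r)], with [r = n^(1/4)]. *)
Lemma size_conditions (R : realType) (a D M K al L r n : R) :
  0 < a -> 1 <= D -> 0 < M -> 0 <= K -> 0 <= al -> 1 <= L -> n = r ^+ 4 ->
  size_const a D M K al * L ^+ 2 <= r ->
  let m := M * L * r in
  [/\ [/\ a * D <= n, 2 * D <= n & 4 <= n],
      3 * a * D ^+ 2 * ((r ^+ 2 * L + 1 + D) / n) * m
        + 2 * D ^+ 2 * (a * D / n * m * (2 * m)) <= 1,
      a * D / n * m <= 1 / 2 &
      forall x, x <= r -> a * D / n * m * (2 * (al * m + K * L * x + 1)) <= 1].
Proof.
move=> a0 D1 M0 K0 al0 L1 nr big m.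
have D0 : 0 < D := lt_le_trans ltr01 D1; have L0 : 0 < L := lt_le_trans ltr01 L1.
have [/ltW a0' /ltW M0' /ltW D0' /ltW L0'] := And4 a0 M0 D0 L0.
move: big; rewrite /size_const.
set c1 := 2 * a * D * M * (al * M + K + 1).
set c2 := 6 * a * D ^+ 2 * (2 + D) * M.
set c3 := 8 * a * D ^+ 3 * M ^+ 2.
set c4 := 2 * a * D * M.
set c5 := a * D.
have alMK : 0 <= al * M + K + 1 by rewrite !addr_ge0 // mulr_ge0.
have c1_0 : 0 <= c1 by rewrite /c1 !mulr_ge0.
have c2_0 : 0 <= c2 by rewrite /c2 !mulr_ge0 ?exprn_ge0 ?addr_ge0.
have c3_0 : 0 <= c3 by rewrite /c3 !mulr_ge0 ?exprn_ge0.
have c4_0 : 0 <= c4 by rewrite /c4 !mulr_ge0.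
have c5_0 : 0 <= c5 by rewrite /c5 !mulr_ge0.
set cst := _ + 4 => big.
have [[c5_cst D_cst four_cst] sum_cst] :
    [/\ c5 <= cst, 2 * D <= cst & 4 <= cst] /\ c1 + c2 + c3 + c4 <= cst.
  by rewrite /cst; clear -c1_0 c2_0 c3_0 c4_0 c5_0 D0'; split; [split|]; lra.
have cst0 : 0 <= cst by apply: le_trans four_cst.
have r1 : cst <= r by apply: le_trans big; rewrite ler_peMr ?exprn_ege1.
have rr : 1 <= r by apply: le_trans (le_trans four_cst r1); rewrite ler1n.
have r0 : 0 < r := lt_le_trans ltr01 rr.
have r_le_n : cst <= n by apply: le_trans r1 _; rewrite nr ler_eXnr.
have n0 : 0 < n by rewrite nr exprn_gt0.
set z := L ^+ 2 / r.
have z0 : 0 <= z by rewrite /z divr_ge0 ?exprn_ge0 ?(ltW r0).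
have cz : (c1 + c2 + c3 + c4) * z <= 1.
  apply: (@le_trans _ _ (cst * z)); first by rewrite ler_wpM2r.
  by rewrite /z mulrA ler_pdivrMr // mul1r.
have w_z : L ^+ 2 / r ^+ 2 <= z.
  by rewrite /z ler_wpM2l ?exprn_ge0 // lef_pV2 ?posrE ?exprn_gt0 // ler_eXnr.
have L_z : L / r ^+ 3 <= z.
  rewrite /z; apply: ler_pM => //; first by rewrite invr_ge0 exprn_ge0 // ltW.
    by rewrite ler_eXnr.
  by rewrite lef_pV2 ?posrE ?exprn_gt0 // ler_eXnr.
have c1z := mulr_ge0 c1_0 z0; have c2z := mulr_ge0 c2_0 z0.
have c3z := mulr_ge0 c3_0 z0; have c4z := mulr_ge0 c4_0 z0.
have rn0 : r != 0 by rewrite gt_eqF.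
have Lr : 1 <= L * r by rewrite mulr_ege1.
have m0 : 0 <= m by rewrite /m !mulr_ge0 ?(ltW r0).
have km : a * D / n * m = c4 / 2 * (L / r ^+ 3) by rewrite /c4 /m nr; field.
have km0 : 0 <= a * D / n * m by rewrite mulr_ge0 // divr_ge0 ?mulr_ge0 // ltW.
split.
- by split; [exact: le_trans c5_cst r_le_n|exact: le_trans D_cst r_le_n|exact: le_trans four_cst r_le_n].
- have h1 : 3 * a * D ^+ 2 * ((r ^+ 2 * L + 1 + D) / n) * m <= c2 / 2 * z.
    have -> : c2 / 2 * z = 3 * a * D ^+ 2 * ((2 + D) * (r ^+ 2 * L) / n) * m.
      by rewrite /c2 /z /m nr; field.
    rewrite ler_wpM2r // ler_wpM2l ?mulr_ge0 ?exprn_ge0 // ler_pM2r ?invr_gt0 //.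
    have rL : 1 <= r ^+ 2 * L by rewrite mulr_ege1 ?exprn_ege1.
    have := ler_wpM2l D0' rL; rewrite mulr1 [(2 + D) * _]mulrDl; clear -rL; lra.
  have h2 : 2 * D ^+ 2 * (a * D / n * m * (2 * m)) <= c3 / 2 * z.
    have -> : 2 * D ^+ 2 * (a * D / n * m * (2 * m)) = c3 / 2 * (L ^+ 2 / r ^+ 2).
      by rewrite /c3 /m nr; field.
    by rewrite ler_wpM2l // divr_ge0.
  apply: le_trans (lerD h1 h2) _; move: c1z c2z c3z c4z cz; clear; lra.
- have h : a * D / n * m <= c4 / 2 * z by rewrite km ler_wpM2l // divr_ge0.
  apply: le_trans h _; move: c1z c2z c3z cz; clear; lra.
- move=> x xr.
  apply: (@le_trans _ _ (a * D / n * m * (2 * ((al * M + K + 1) * (L * r))))).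
    rewrite ler_wpM2l // ler_pM2l //.
    have := ler_wpM2l (mulr_ge0 K0 L0') xr; rewrite /m; clear -Lr; lra.
  have -> : a * D / n * m * (2 * ((al * M + K + 1) * (L * r))) = c1 * (L ^+ 2 / r ^+ 2).
    by rewrite /c1 /m nr; field.
  have := ler_wpM2l c1_0 w_z; move: c2z c3z c4z cz; clear; lra.
Qed.

Theorem theorem4p2 (R : realType) (d : nat) (a b c : R) :
  (3 <= d)%N -> 0 < b -> b <= a ->
  1 < alpha d a b -> alpha d a b < beta d a b ^+ 2 ->
  0 < c -> c * ln (alpha d a b) < 1 / 4 ->
  exists C gamma K : R, [/\ 0 < C, 0 < gamma, 0 < K &
    exists N : nat, forall n : nat, (N <= n)%N ->
      1 - K * (n%:R) `^ (- gamma) <=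
      hsbm_prob d (pn n d a) (pn n d b) (good_event n d a b C (ell c n))].
Proof.
move=> d3 b0 ba al1 be_gt c0 cal.
have a0 : 0 < a := lt_le_trans b0 ba.
have d1 : 1 <= d%:R :> R by rewrite ler1n; lia.
set al := alpha d a b; set rho := Num.sqrt al; set be := beta d a b.
have rho_al : rho < al := al_rho al1.
have rho_be : rho < be := be_rho ba al1 be_gt.
set G := (al - rho)^-1; have G0 : 0 < G by rewrite invr_gt0 subr_gt0.
set k0 := 2 * d%:R * (a + 3) + 2.
have k00 : 0 < k0 by rewrite addr_gt0 // !mulr_gt0 //; lra.
(* [Q ^+ 2] must dominate an expression containing [K], itself linear in [Q]. Here
   [Q ^+ 2 = Q + Q * k0 * G], and [Q * k0 = K + 2 * Q >= K + 2]. *)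
set Q := 1 + k0 * G.
have Q1 : 1 <= Q by rewrite lerDl mulr_ge0 ?ltW.
have Q0 : 0 < Q by lra.
set K := dev_const d a Q.
have K0 : 0 <= K by rewrite /K /dev_const !mulr_ge0 //; lra.
have Q_large : 1 + (K + 2) / (al - rho) <= Q ^+ 2.
  have e : Q ^+ 2 = Q + Q * k0 * G by rewrite /Q; ring.
  rewrite e -/G; apply: lerD => //; rewrite ler_wpM2r ?(ltW G0) //.
  by rewrite /K /dev_const /k0; lra.
have ial : 0 < (al - 1)^-1 by rewrite invr_gt0 subr_gt0.
(* One constant for both roles of [m]: bounding a layer, and bounding the ball inside it, which
   costs [1 / (al - 1)]. *)
set M := Q ^+ 2 * (1 + (al - 1)^-1).
have QM : Q ^+ 2 <= M by rewrite /M ler_peMr ?sqr_ge0 //; lra.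
have QM' : Q ^+ 2 / (al - 1) <= M by rewrite /M ler_wpM2l ?sqr_ge0 //; lra.
have M0 : 0 < M by apply: lt_le_trans QM; rewrite exprn_gt0.
have al0 : 0 <= al := ltW (lt_trans ltr01 al1).
have four_cst : 4 <= size_const a d%:R M K al.
  by apply: size_const_ge4 => //; exact: ltW.
set cst := size_const _ _ _ _ _ in four_cst.
(* The spin imbalance costs [2 * expR 2 / n]; the explorations cost [n * l * 4 / n^3 <= 4 c L / n^2
   <= 4 c / n], as [l <= c L] and [L <= n]. *)
exists (good_const d a b Q), 1, (2 * expR (2 : R) + 4 * c); split => //.
- have g1 : 0 < (be - rho)^-1 by rewrite invr_gt0 subr_gt0.
  rewrite /good_const -/al -/rho -/be -/K -/G.
  have : 0 <= (K + 2) * G by rewrite mulr_ge0 ?addr_ge0 ?(ltW G0).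
  have : 0 <= (K + 2) / (be - rho) by rewrite mulr_ge0 ?addr_ge0 ?(ltW g1).
  have := sqr_ge0 Q; lra.
- by rewrite addr_gt0 ?mulr_gt0 ?expR_gt0.
(* Forces [ln n >= 384 * cst + 1], the input that [expR_quarter_ge] needs for
   [cst * L ^+ 2 <= n^(1/4)]. *)
exists (Num.truncn (expR (384 * cst + 1))).+1 => n Nn.
set L := ln (n%:R : R).
have nexp : expR (384 * cst + 1) <= n%:R.
  by apply: ltW; apply: lt_le_trans (truncnS_gt _) _; rewrite ler_nat.
have n0 : 0 < n%:R :> R by apply: lt_le_trans nexp; rewrite expR_gt0.
have nL : n%:R = expR L by rewrite lnK.
have Lge : 384 * cst + 1 <= L by rewrite -ler_expR -nL.
have L1 : 1 <= L by clear -Lge four_cst; lra.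
have L0 : 0 <= L := le_trans ler01 L1.
set r := expR (L / 4).
have rbig : cst * L ^+ 2 <= r by apply: expR_quarter_ge; clear -Lge four_cst; lra.
have nr : n%:R = r ^+ 4 by rewrite nL /r -expRM_natl; congr expR; field.
have sqn : Num.sqrt (n%:R : R) = r ^+ 2.
  by rewrite nr (exprM r 2 2) sqrtr_sqr ger0_norm ?exprn_ge0 ?expR_ge0.
set l := ell c n.
have lL : l%:R <= c * L.
  by rewrite /l /ell -/L truncn_le // mulr_ge0 // ltW.
(* Here the bound on [c] enters: [l * ln al <= c * L * ln al <= L / 4]. *)
have al_l : al ^+ l <= r.
  rewrite -[al]lnK ?posrE; last exact: lt_trans al1.
  rewrite -expRM_natl ler_expR.
  have lnal : 0 <= ln al by rewrite ln_ge0 // ltW.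
  have := ler_wpM2r lnal lL; have := ler_wpM2l (_ : 0 <= L) (ltW cal).
  by rewrite -/al => /(_ L0); clear; lra.
have rho_l : rho ^+ l <= r.
  apply: le_trans al_l; by apply: lerXn2r; rewrite ?nnegrE ?sqrtr_ge0 ?(ltW rho_al).
set m := M * L * r.
have [[aD_n D_n n4] mean_small kappa_m overlap] :=
  size_conditions a0 d1 M0 K0 al0 L1 nr rbig.
apply: (@le_trans _ _ (1 - (2 * expR (2 : R) / n%:R + n%:R * (l%:R * (4 * expR (- 3 * L)))))).
  rewrite lerD2l lerN2 powRN powRr1 ?(ltW n0) //.
  have -> : expR (- 3 * L) = (n%:R ^+ 3)^-1 by rewrite nL -expRM_natl -expRN mulNr.
  rewrite [leRHS]mulrDl lerD2l.
  have -> : n%:R * (l%:R * (4 / n%:R ^+ 3)) = 4 * (l%:R / n%:R) / n%:R :> R.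
    by field; rewrite gt_eqF.
  rewrite ler_pM2r ?invr_gt0 // ler_pM2l // ler_pdivrMr //.
  apply: le_trans lL _; rewrite ler_pM2l // nL.
  by apply: le_trans (expR_ge1Dx L); rewrite lerDr.
have dn : (2 * d <= n)%N by rewrite -(ler_nat R) natrM.
apply: (@good_event_prob _ _ _ _ _ m) => //.
- by rewrite -(ler_nat R).
(* Edge probabilities are at most 1 because [1 / N <= C(n - 2, d - 2) / N <= d / n] and
   [a * d <= n]. *)
- have := @codeg_ratio R n d d3 dn; set N := ('C(n, d.-1))%:R.
  have N0 : 0 < N :> R by rewrite ltr0n bin_gt0; clear -dn; lia.
  have C1 : 1 <= ('C(n - 2, d - 2))%:R :> R by rewrite ler1n bin_gt0; clear -dn; lia.
  move=> h; have : N^-1 <= d%:R / n%:R.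
    by apply: le_trans h; rewrite ler_peMl // invr_ge0 ltW.
  move=> /(ler_wpM2l (ltW a0)) h2; apply: le_trans h2 _.
  by rewrite mulrA ler_pdivrMr // mul1r.
- by rewrite sqn.
- exact: overlap.
- rewrite -/al /m; apply: ler_pM; rewrite ?mulr_ge0 ?exprn_ge0 ?(ltW Q0) //.
  by rewrite ler_wpM2r.
- rewrite -/al /m mulrAC; apply: ler_pM; rewrite ?mulr_ge0 ?exprn_ge0 ?(ltW Q0) ?(ltW ial) //.
  by rewrite mulrAC ler_wpM2r.
Qed.
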